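(* Assume (A1) and (A3) below. Then for every $D>0$, $$R_{\mathrm{pr}}(D,0)=R(D,0).$$ (A1) For each fixed $\mu\in\mathcal P(\mathcal X)$, the map $\nu\mapsto d(\mu,\nu)$ is convex. (A3) For every $D>0$ and $\epsilon>0$ there exist random variables $\tilde X$ and $\hat X$ on $\mathcal X$, jointly distributed with $X$, such that all of the following hold: - $\tilde X$ is discrete with finite support; - $X\leftrightarrow\tilde X\leftrightarrow\hat X$ is a Markov chain; - $I(X;\tilde X)\le R(D,0)+\epsilon$; - $\mathbb E[\Delta(X,\hat X)]\le D$; - $p_{\hat X}=p_X$.
   Context: Let $\mathcal X$ be a Polish metric space with its Borel $\sigma$-algebra, and let $\mathcal P(\mathcal X)$ be the set of Borel probability measures on $\mathcal X$. Let $X\sim p_X\in\mathcal P(\mathcal X)$, and let $\{X_t\}_{t\ge1}$ be i.i.d. with marginal $p_X$. Let $\Delta:\mathcal X\times\mathcal X\to[0,\infty)$ be a measurable distortion function with $\Delta(x,\hat x)=0$ iff $x=\hat x$. Let $d:\mathcal P(\mathcal X)\times\mathcal P(\mathcal X)\to[0,\infty]$ be a divergence with $d(\mu,\nu)=0$ iff $\mu=\nu$. The rate-distortion-perception function is $$R(D,P):=\inf I(X;\hat X),$$ where the infimum is over Markov kernels $p_{\hat X|X}$ from $\mathcal X$ to $\mathcal X$ with $\mathbb E[\Delta(X,\hat X)]\le D$ and $d(p_X,p_{\hat X})\le P$. Thus $R(D,0)$ is the infimum of $I(X;\hat X)$ subject to $\mathbb E[\Delta(X,\hat X)]\le D$ and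 $p_{\hat X}=p_X$. Operational definition. A rate $R$ is achievable with private randomness if, for all sufficiently large $n$, there exist: - an encoder kernel $p_{Z|X^n}$ with $Z$ taking values in a countable set; - a decoder kernel $p_{\hat X^n|Z}$ with $\hat X^n\in\mathcal X^n$; such that, under $p_X^np_{Z|X^n}p_{\hat X^n|Z}$, the following hold: - $\frac1nH(Z)\le R$; - $\frac1n\sum_{t=1}^n\mathbb E[\Delta(X_t,\hat X_t)]\le D$; - $d(p_X,p_{\hat X_t})\le P$ for all $t\in[1:n]$. $R_{\mathrm{pr}}(D,P)$ is the infimum of such $R$. *)

(* Defs.v *)
From HB Require Import structures.
From mathcomp Require Import all_boot all_order all_algebra.
From mathcomp Require Import all_classical all_reals all_analysis.
Set Implicit Arguments. Unset Strict Implicit. Unset Printing Implicit Defensive.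
Import Order.TTheory GRing.Theory Num.Theory.
Local Open Scope classical_set_scope.
Local Open Scope ring_scope.

Section polish.
Context {R : realType} {T : Type}.
Implicit Types dist : T -> T -> R.

Definition is_metric dist :=
  [/\ (forall x y, 0 <= dist x y), (forall x y, dist x y = 0 <-> x = y),
      (forall x y, dist x y = dist y x) &
      (forall x y z, dist x z <= dist x y + dist y z)].

Definition metric_open dist (A : set T) :=
  forall x, A x -> exists2 r : R, 0 < r & [set y | dist x y < r] `<=` A.

Definition metric_complete dist :=
  forall u : nat -> T,
    (forall e : R, 0 < e -> exists N, forall m n, (N <= m)%N -> (N <= n)%N ->
       dist (u m) (u n) < e) ->
    exists l, forall e : R, 0 < e -> exists N, forall n, (N <= n)%N -> dist (u n) l < e.

Definition metric_separable dist :=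
  exists u : nat -> T, forall x (e : R), 0 < e -> exists n, dist x (u n) < e.
End polish.

Definition polish_borel {R : realType} {d} (T : measurableType d) (dist : T -> T -> R) :=
  [/\ is_metric dist, metric_complete dist, metric_separable dist &
      (@measurable d T = <<s [set A | metric_open dist A] >>)].

Local Open Scope ereal_scope.

Section divergence.
Context {R : realType} {d} (T : measurableType d).

Definition is_distortion (Delta : T -> T -> R) :=
  [/\ measurable_fun [set: T * T] (fun p => Delta p.1 p.2),
      (forall x y, (0 <= Delta x y)%R) &
      (forall x y, Delta x y = 0%R <-> x = y)].

(* Two mathcomp probability records represent the same element of P(X) iff *)
(* they agree on the (Borel) measurable sets.                              *)
Definition same_law (mu nu : set T -> \bar R) :=
  forall A, measurable A -> mu A = nu A.

Definition is_divergence (dv : probability T R -> probability T R -> \bar R) :=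
  [/\ (forall mu nu : probability T R, 0 <= dv mu nu),
      (forall mu mu' nu nu' : probability T R, same_law mu mu' -> same_law nu nu' ->
         dv mu nu = dv mu' nu') &
      (forall mu nu : probability T R, dv mu nu = 0 <-> same_law mu nu)].

Definition divergence_convex (dv : probability T R -> probability T R -> \bar R) :=
  forall (mu nu1 nu2 nu : probability T R) (t : R), (0 <= t <= 1)%R ->
    same_law nu (fun A => t%:E * nu1 A + (1 - t)%:E * nu2 A) ->
    dv mu nu <= t%:E * dv mu nu1 + (1 - t)%:E * dv mu nu2.
End divergence.

(* Mutual information of a joint law (given as a set function on X * Y),     *)
(* general (Dobrushin / Gelfand-Yaglom-Perez) definition: supremum over      *)
(* finite measurable partitions of the discrete mutual information.          *)
(* Natural logarithms are used throughout (nats).                            *)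
Section mutual_information.
Context {R : realType} {d1 d2} (X : measurableType d1) (Y : measurableType d2).

Definition mi_term (p a b : R) : R :=
  if p == 0%R then 0%R else (p * ln (p / (a * b)))%R.

Definition finite_mpartition {dU} (T : measurableType dU) (m : nat)
  (A : 'I_m -> set T) :=
  [/\ (forall i, measurable (A i)),
      (forall i j, i != j -> A i `&` A j = set0) &
      \big[setU/set0]_(i < m) A i = setT].

Definition mutual_info (pi : set (X * Y) -> \bar R) : \bar R :=
  ereal_sup [set v | exists (m k : nat) (A : 'I_m -> set X) (B : 'I_k -> set Y),
    [/\ finite_mpartition A, finite_mpartition B &
     v = (\sum_(i < m) \sum_(j < k)
            mi_term (fine (pi (A i `*` B j))) (fine (pi (A i `*` setT)))
                    (fine (pi (setT `*` B j))))%:E]].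
End mutual_information.

Definition entropy {R : realType} (p : nat -> R) : \bar R :=
  \sum_(0 <= z <oo) (- (p z * ln (p z)))%:E.

Section rdp.
Context {R : realType} {d} (X : measurableType d).
Variables (PX : probability X R) (Delta : X -> X -> R)
  (dv : probability X R -> probability X R -> \bar R).

Definition joint_law (k : R.-pker X ~> X) : set (X * X) -> \bar R :=
  fun C => \int[PX]_x k x [set y | C (x, y)].

Definition out_law (k : R.-pker X ~> X) : set X -> \bar R :=
  fun B => \int[PX]_x k x B.

Definition exp_distortion (k : R.-pker X ~> X) : \bar R :=
  \int[PX]_x \int[k x]_y (Delta x y)%:E.

Definition RDP (D P : R) : \bar R :=
  ereal_inf [set mutual_info (joint_law k) | k in
    [set k : R.-pker X ~> X | exp_distortion k <= D%:E /\
       exists nu : probability X R, same_law nu (out_law k) /\ dv PX nu <= P%:E]].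
End rdp.

Section operational.
Context {R : realType} {d} (X : measurableType d).
Variables (PX : probability X R) (Delta : X -> X -> R)
  (dv : probability X R -> probability X R -> \bar R).

Definition iid_law n (Pn : probability (n.-tuple X) R) :=
  forall A : 'I_n -> set X, (forall i, measurable (A i)) ->
    Pn [set x | forall i, A i (tnth x i)] = \prod_(i < n) PX (A i).

(* Z takes values in a countable set, w.l.o.g. nat *)
Definition code_pmf n (Pn : probability (n.-tuple X) R)
  (enc : R.-pker (n.-tuple X) ~> nat) (z : nat) : R :=
  fine (\int[Pn]_x enc x [set z]).

Definition code_avg_distortion n (Pn : probability (n.-tuple X) R)
  (enc : R.-pker (n.-tuple X) ~> nat) (dec : R.-pker nat ~> n.-tuple X) : \bar R :=
  ((n%:R)^-1)%:E * \sum_(t < n)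
     \int[Pn]_x \int[enc x]_z \int[dec z]_y (Delta (tnth x t) (tnth y t))%:E.

Definition code_out_law n (Pn : probability (n.-tuple X) R)
  (enc : R.-pker (n.-tuple X) ~> nat) (dec : R.-pker nat ~> n.-tuple X)
  (t : 'I_n) : set X -> \bar R :=
  fun B => \int[Pn]_x \int[enc x]_z dec z [set y | B (tnth y t)].

Definition achievable_pr (D P r : R) :=
  exists N : nat, forall n : nat, (N <= n)%N ->
    forall Pn : probability (n.-tuple X) R, iid_law Pn ->
    exists (enc : R.-pker (n.-tuple X) ~> nat) (dec : R.-pker nat ~> n.-tuple X),
      [/\ ((n%:R)^-1)%:E * entropy (code_pmf Pn enc) <= r%:E,
          code_avg_distortion Pn enc dec <= D%:E &
          forall t : 'I_n, exists nu : probability X R,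
            same_law nu (code_out_law Pn enc dec t) /\ dv PX nu <= P%:E].

Definition Rpr (D P : R) : \bar R :=
  ereal_inf [set r%:E | r in [set r : R | achievable_pr D P r]].
End operational.

Definition assumption_A3 {R : realType} {d} (X : measurableType d)
  (PX : probability X R) (Delta : X -> X -> R)
  (dv : probability X R -> probability X R -> \bar R) :=
  forall D eps : R, (0 < D)%R -> (0 < eps)%R ->
  exists (dO : measure_display) (O : measurableType dO) (P : probability O R)
         (X0 Xt Xh : O -> X),
    [/\ measurable_fun setT X0, measurable_fun setT Xt, measurable_fun setT Xh &
        same_law (fun A => P (X0 @^-1` A)) PX] /\
    [/\
        exists S : set X, finite_set S /\ P (Xt @^-1` S) = 1,
        (forall (A B : set X) (s : X), measurable A -> measurable B ->
           P [set w | A (X0 w) /\ Xt w = s /\ B (Xh w)] * P (Xt @^-1` [set s]) =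
           P [set w | A (X0 w) /\ Xt w = s] * P [set w | Xt w = s /\ B (Xh w)]),
        mutual_info (fun C => P [set w | C (X0 w, Xt w)]) <= RDP PX Delta dv D 0 + eps%:E,
        \int[P]_w (Delta (X0 w) (Xh w))%:E <= D%:E &
        same_law (fun A => P (Xh @^-1` A)) PX].

(* Main.v *)
Require Import Defs.
From HB Require Import structures.
From mathcomp Require Import all_boot all_order all_algebra.
From mathcomp Require Import all_classical all_reals all_analysis.
From mathcomp Require Import measurable_realfun ring lra.
Set Implicit Arguments. Unset Strict Implicit. Unset Printing Implicit Defensive.
Import Order.TTheory GRing.Theory Num.Theory.

(** Converse.  Given a code, let [K] be the average over [t] of the conditional
    laws of [Xhat_t] given [X_t].  For finite partitions, let [q] be the
    information density of the quantised pair under [K].  Applying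
    [1 + ln x <= x] to [x = p(z) \prod_t q(i_t, j_t)], for one codeword [z] at a
    time, bounds [n] times the information of [K] by [H(Z)] in one stroke.

    Achievability.  (A3) gives a finite alphabet [S], a channel [W] from the
    source to [S] and laws [Q_s] on the reproduction side.  A random codebook of
    [K ~ exp (n I)] i.i.d. words together with a likelihood encoder simulates
    the typical part of the block channel [W^n]; the part which is missed is
    sent uncoded, so that the average over codebooks reproduces [W^n] exactly.
    The constraints (law of each letter, distortion of each letter, probability
    of the uncoded mode) are finitely many linear functionals of the codebook
    distribution, so by Caratheodory the same averages are obtained with
    [O(n)] codebooks.  The encoder draws the codebook privately and transmits
    its index, at rate [O(ln n / n)]: hence all letters have law exactly [PX]. *)

Local Open Scope ring_scope.

(** * Finite linear algebra and finite probability *)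

(** A perception constraint of level zero forbids any approximation of the output law, and encoder
    and decoder share no randomness, so every constraint has to be met exactly. The likelihood
    encoder divides by [Num.max 1 mean] and not by the mean of the likelihoods: averaged over
    codebooks it then never gives a word more mass than [W^n] does, so the deficit is nonnegative
    and a fallback mode can supply it. An uncoded word costs up to [n ln #|S|] nats, which is
    affordable because that mode has small probability. The law of an output letter is a mixture of
    the [Q_s], hence is fixed by the [#|S|] probabilities of its symbol; with the distortion this
    makes [n (#|S| + 1)] functionals, plus the uncoded probability and the total mass. Unbounded
    distortion is harmless, as its mean is preserved and not estimated. Information being a supremum
    over finite partitions, typicality is defined by rounding [W] to a grid: the cells form such a
    partition, and the rounded information density takes finitely many values, so Chebyshev's
    inequality applies. *)

Lemma nonzero_left_kernel (F : fieldType) (m n : nat) (M : 'M[F]_(m, n)) :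
  (n < m)%N -> exists2 u : 'rV[F]_m, u != 0 & u *m M = 0.
Proof.
move=> nm; have : kermx M != 0.
  by rewrite kermx_eq0 /row_free neq_ltn (leq_ltn_trans (rank_leq_col M) nm).
case/rowV0Pn => u /sub_kermxP uM u0.
by exists u.
Qed.

Lemma linear_relation (F : fieldType) (C I : finType) (V : C -> I -> F) (A : {set C}) :
  (#|I| < #|A|)%N ->
  exists u : C -> F, [/\ (forall c, c \notin A -> u c = 0), (exists c, u c != 0) &
    forall i, \sum_c u c * V c i = 0].
Proof.
move=> IA; pose M : 'M[F]_(#|A|, #|I|) := \matrix_(i, j) V (enum_val i) (enum_val j).
have [w w0 wM] := nonzero_left_kernel M IA.
have [c0 c0A] : exists c, c \in A by apply/card_gt0P; apply: leq_ltn_trans IA.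
exists (fun c => if c \in A then w 0 (enum_rank_in c0A c) else 0); split.
- by move=> c /negbTE ->.
- have [j wj] : exists j, w 0 j != 0.
    apply/existsP; apply: contraR w0; rewrite negb_exists => /forallP h.
    by apply/eqP/rowP => j; rewrite mxE; apply/eqP/negPn.
  by exists (enum_val j); rewrite enum_valP enum_valK_in.
- move=> i; have /rowP/(_ (enum_rank i)) := wM; rewrite !mxE => eq0; rewrite -[RHS]eq0.
  rewrite (bigID (mem A)) /= [X in _ + X]big1 ?addr0; last first.
    by move=> c /negbTE ->; rewrite mul0r.
  rewrite (big_enum_val (fun c => (if c \in A then w 0 (enum_rank_in c0A c) else 0) * V c i)).
  apply: eq_bigr => j _; rewrite enum_valP enum_valK_in mxE enum_rankK //.
Qed.

(** Conic form: while the support has more points than there are functionals, a linear relation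
    among the rows lets the weights slide until one vanishes. Total mass is kept only if the caller
    puts a constant functional into [V]. *)
Lemma caratheodory (R : realFieldType) (C I : finType) (V : C -> I -> R) (lam : C -> R) :
  (forall c, 0 <= lam c) ->
  exists mu : C -> R, [/\ (forall c, 0 <= mu c), (#|[set c | mu c != 0%R]| <= #|I|)%N &
    forall i, \sum_c mu c * V c i = \sum_c lam c * V c i].
Proof.
have [n] := ubnP #|[set c | lam c != 0%R]|.
elim: n => // n IH in lam *; move=> sn lam0.
have [le|lt] := leqP #|[set c | lam c != 0%R]| #|I|; first by exists lam.
have [u0 [u0A u0n u0V]] := linear_relation V lt.
(* Up to a change of sign the relation has a positive entry, so that moving along it does decrease
   some weight. *)
have [u [uA [c0 uc0] uV]] : exists u : C -> R,
    [/\ (forall c, c \notin [set c | lam c != 0%R] -> u c = 0),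
        (exists c, 0 < u c) & forall i, \sum_c u c * V c i = 0].
  case: u0n => c; case: (ltgtP (u0 c) 0) => // uc _.
  - exists (fun c => - u0 c); split; first by move=> c' /u0A ->; rewrite oppr0.
    + by exists c; rewrite oppr_gt0.
    + by move=> i; under eq_bigr do rewrite mulNr; rewrite sumrN u0V oppr0.
  - by exists u0; split => //; exists c.
(* move along [u] until the first weight vanishes *)
pose c1 := [arg min_(c < c0 | 0 < u c) (lam c / u c)]%O.
have [uc1 min1] : 0 < u c1 /\ forall c, 0 < u c -> lam c1 / u c1 <= lam c / u c.
  by rewrite /c1; case: arg_minP => // c uc h; split.
pose t := lam c1 / u c1.
have t0 : 0 <= t by rewrite divr_ge0 // ltW.
pose mu c := lam c - t * u c.
have mu0 c : 0 <= mu c.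
  rewrite /mu subr_ge0; have [uc|uc] := ltP 0 (u c).
    by rewrite -ler_pdivlMr //; exact: min1.
  by apply: le_trans (lam0 c); rewrite mulr_ge0_le0.
have muV i : \sum_c mu c * V c i = \sum_c lam c * V c i.
  transitivity (\sum_c lam c * V c i - t * \sum_c u c * V c i).
    by rewrite mulr_sumr -sumrB; apply: eq_bigr => c _; rewrite /mu mulrBl mulrA.
  by rewrite uV mulr0 subr0.
have [|//|nu [nu0 nuI nuV]] := IH mu.
  rewrite -ltnS; apply: leq_trans sn; rewrite ltnS; apply: proper_card.
  apply/properP; split.
    apply/fintype.subsetP => c; rewrite !inE; apply: contraNneq => lc.
    by rewrite /mu lc uA ?mulr0 ?subr0 // inE lc eqxx.
  exists c1; rewrite !inE; last by rewrite negbK /mu /t divfK ?subrr // gt_eqF.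
  by apply: contraTneq uc1 => lc; rewrite uA ?ltxx // inE lc eqxx.
by exists nu; split => // i; rewrite nuV muV.
Qed.

(** The factor [g] is absorbed into the [i]-th law, and distributivity turns the sum over functions
    into a product of sums, all but one equal to 1. The laws may vary with the coordinate, as for a
    memoryless channel with a given input block. *)
Lemma prod_kernel_factor1 (R : realFieldType) (I T : finType) (P : I -> T -> R) :
  (forall i, \sum_t P i t = 1) -> forall (g : T -> R) (i : I),
  \sum_(c : {ffun I -> T}) (\prod_k P k (c k)) * g (c i) = \sum_t P i t * g t.
Proof.
move=> P1 g i; pose G k t := P k t * (if k == i then g t else 1).
transitivity (\sum_(c : {ffun I -> T}) \prod_k G k (c k)).
  apply: eq_bigr => c _; rewrite big_split /=; congr (_ * _).
  by rewrite (bigD1 i) //= eqxx big1 ?mulr1 // => k /negbTE ->.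
rewrite -bigA_distr_bigA /= (bigD1 i) //= [X in _ * X]big1 ?mulr1; last first.
  move=> k /negbTE ki; rewrite -[RHS](P1 k).
  by apply: eq_bigr => t _; rewrite /G ki mulr1.
by rewrite /G eqxx.
Qed.

Lemma prod_kernel1 (R : realFieldType) (I T : finType) (P : I -> T -> R) :
  (forall i, \sum_t P i t = 1) -> \sum_(c : {ffun I -> T}) \prod_k P k (c k) = 1.
Proof. by move=> P1; rewrite -bigA_distr_bigA /= big1. Qed.

Section product_pmf.
Context {R : realFieldType} {I T : finType} (P : T -> R).
Hypothesis P1 : \sum_t P t = 1.

Lemma prod_pmf1 : \sum_(c : {ffun I -> T}) \prod_i P (c i) = 1.
Proof. exact: (@prod_kernel1 R I T (fun=> P)). Qed.

Lemma prod_pmf_factor2 (g h : T -> R) (i j : I) : i != j ->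
  \sum_(c : {ffun I -> T}) (\prod_k P (c k)) * (g (c i) * h (c j)) =
  (\sum_t P t * g t) * (\sum_t P t * h t).
Proof.
move=> ij; pose G k t := P t * (if k == i then g t else if k == j then h t else 1).
transitivity (\sum_(c : {ffun I -> T}) \prod_k G k (c k)).
  apply: eq_bigr => c _; rewrite big_split /=; congr (_ * _).
  rewrite (bigD1 i) //= eqxx (bigD1 j) /= 1?eq_sym // (negbTE ij) eqxx big1 ?mulr1 //.
  by move=> k /andP[/negbTE -> /negbTE ->].
rewrite -bigA_distr_bigA /= (bigD1 i) //= (bigD1 j) /= 1?eq_sym // mulrA [X in _ * X]big1 ?mulr1.
  by rewrite /G !eqxx (eq_sym j i) (negbTE ij).
move=> k /andP[/negbTE ki /negbTE kj]; rewrite -[RHS]P1.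
by apply: eq_bigr => t _; rewrite /G ki kj mulr1.
Qed.

Lemma prod_pmf_factor1 (g : T -> R) (i : I) :
  \sum_(c : {ffun I -> T}) (\prod_k P (c k)) * g (c i) = \sum_t P t * g t.
Proof. exact: (@prod_kernel_factor1 R I T (fun=> P)). Qed.

(** Variance of an i.i.d. sum: the cross terms vanish by independence and centring. *)
Lemma prod_pmf_sqr (h : T -> R) : \sum_t P t * h t = 0 ->
  \sum_(c : {ffun I -> T}) (\prod_k P (c k)) * (\sum_i h (c i)) ^+ 2 =
  #|I|%:R * \sum_t P t * h t ^+ 2.
Proof.
move=> h0.
transitivity (\sum_i \sum_j \sum_(c : {ffun I -> T}) (\prod_k P (c k)) * (h (c i) * h (c j))).
  under [RHS]eq_bigr do rewrite exchange_big.
  rewrite [RHS]exchange_big; apply: eq_bigr => c _.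
  rewrite expr2 mulr_suml mulr_sumr; apply: eq_bigr => i _.
  by rewrite mulr_sumr mulr_sumr.
rewrite mulr_natl -sumr_const; apply: eq_bigr => i _.
rewrite (bigD1 i) //= [X in _ + X]big1 ?addr0 => [|j ji].
  exact: (prod_pmf_factor1 (fun t => h t ^+ 2)).
by rewrite prod_pmf_factor2 1?eq_sym // h0 mul0r.
Qed.
End product_pmf.

Lemma ln_le_sub1 (R : realType) (x : R) : 0 < x -> ln x <= x - 1.
Proof.
move=> x0; have := @le_ln1Dx R (x - 1); rewrite addrCA subrr addr0; apply.
by rewrite ltrBrDl subrr.
Qed.

(** Termwise Gibbs inequality. The defect [q - p] is kept because it sums to at most zero as soon as
    [q] has no more total mass than [p]. *)
Lemma gibbs_term (R : realType) (p q : R) : 0 <= p -> 0 < q ->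
  - (p * ln p) <= - (p * ln q) + (q - p).
Proof.
move=> p0 q0; have [->|pn] := eqVneq p 0.
  by rewrite !mul0r oppr0 add0r addr0 ltW.
have pp : 0 < p by rewrite lt_neqAle eq_sym pn.
have := ln_le_sub1 (divr_gt0 q0 pp).
rewrite ln_div ?posrE // => h.
have : p * (ln q - ln p) <= p * (q / p - 1) by rewrite ler_pM2l.
rewrite !mulrBr mulr1 mulrCA divff // mulr1; lra.
Qed.

(** * Random codebooks and the likelihood encoder *)

Section random_codebook.
Context {R : realFieldType} {T : finType} (K : nat) (P : T -> R).
Hypotheses (K0 : (0 < K)%N) (P0 : forall t, 0 <= P t) (P1 : \sum_t P t = 1).

Definition book_prob (c : {ffun 'I_K -> T}) : R := \prod_k P (c k).

Definition book_mean (f : T -> R) (c : {ffun 'I_K -> T}) : R :=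
  (\sum_k f (c k)) / K%:R.

(** Probability that the likelihood encoder picks entry [k]. These probabilities add up to
    [min(1, mean)]; the rest is a failure of the encoder. *)
Definition book_sel (f : T -> R) (c : {ffun 'I_K -> T}) (k : 'I_K) : R :=
  f (c k) / (K%:R * Num.max 1 (book_mean f c)).

Variable f : T -> R.
Hypothesis f0 : forall t, 0 <= f t.

Let K0R : 0 < K%:R :> R. Proof. by rewrite ltr0n. Qed.

Lemma book_prob_ge0 c : 0 <= book_prob c.
Proof. by apply: prodr_ge0. Qed.

Let mx1 c : 1 <= Num.max 1 (book_mean f c).
Proof. by rewrite le_max lexx. Qed.

Lemma book_sel_ge0 c k : 0 <= book_sel f c k.
Proof. by rewrite divr_ge0 // mulr_ge0 ?ltW // (lt_le_trans ltr01). Qed.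

Lemma book_sel_sum c :
  \sum_k book_sel f c k = book_mean f c / Num.max 1 (book_mean f c).
Proof. by rewrite -mulr_suml invfM mulrA. Qed.

Lemma book_sel_sum_le1 c : \sum_k book_sel f c k <= 1.
Proof.
rewrite book_sel_sum ler_pdivrMr ?mul1r ?(lt_le_trans ltr01) //.
by rewrite le_max lexx orbT.
Qed.

(** Replacing the [Num.max] by 1 only increases the weights, and what remains is unbiased: each of
    the [K] entries contributes [P s * f s / K]. *)
Lemma book_sel_le s :
  \sum_c book_prob c * \sum_(k | c k == s) book_sel f c k <= P s * f s.
Proof.
apply: (@le_trans _ _
  (\sum_c book_prob c * \sum_k (K%:R^-1 * (f (c k) * (c k == s)%:R)))).
  apply: ler_sum => c _; apply: ler_wpM2l; first exact: book_prob_ge0.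
  rewrite big_mkcond /=; apply: ler_sum => k _; case: ifP => ks /=; last by rewrite !mulr0.
  rewrite mulr1 /book_sel invfM [leRHS]mulrC ler_wpM2l //.
  by rewrite ler_piMr ?invr_ge0 ?(ltW K0R) // invf_le1 ?(lt_le_trans ltr01).
rewrite le_eqVlt; apply/orP; left; apply/eqP.
under eq_bigr do rewrite mulr_sumr.
rewrite exchange_big /=.
under eq_bigr => k _.
  under eq_bigr do rewrite mulrCA.
  rewrite -mulr_sumr.
  have -> : \sum_c book_prob c * (f (c k) * (c k == s)%:R) = P s * f s.
    etransitivity; first exact: (prod_pmf_factor1 P1 (fun t => f t * (t == s)%:R)).
    rewrite (bigD1 s) //= eqxx mulr1 big1 ?addr0 // => t /negbTE ->.
    by rewrite !mulr0.
  over.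
by rewrite sumr_const card_ord -mulrnAl -[_ *+ K]mulr_natr mulVf ?gt_eqF // mul1r.
Qed.

(** The codebook mean of [f] has expectation [mu] and variance at most [M / K], hence at most
    [gam ^+ 2]; since [mu <= 1], cutting it at 1 loses little. *)
Lemma book_miss (M gam : R) : 0 < gam -> (forall t, f t <= M) ->
  \sum_t P t * f t <= 1 -> M <= gam ^+ 2 * K%:R ->
  1 - \sum_c book_prob c * \sum_k book_sel f c k <= 1 - \sum_t P t * f t + gam.
Proof.
move=> gam0 fM; set mu := \sum_t _ => mu1 MK.
pose F := book_mean f; pose h t := f t - mu.
have h0 : \sum_t P t * h t = 0.
  rewrite (eq_bigr (fun t => P t * f t - P t * mu)); last by move=> t _; rewrite mulrBr.
  by rewrite sumrB -mulr_suml P1 mul1r subrr.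
have EF : \sum_c book_prob c * F c = mu.
  rewrite /F /book_mean; under eq_bigr do rewrite mulrA mulr_sumr.
  rewrite -mulr_suml exchange_big /=.
  under eq_bigr do rewrite (prod_pmf_factor1 P1 f).
  by rewrite sumr_const card_ord -[_ *+ K]mulr_natr mulfK // gt_eqF.
have Fh c : F c - mu = (\sum_k h (c k)) / K%:R.
  rewrite /F /book_mean /h sumrB sumr_const card_ord -[mu *+ K]mulr_natr mulrBl.
  by rewrite mulfK // gt_eqF.
have mu0 : 0 <= mu by apply: sumr_ge0 => t _; rewrite mulr_ge0.
have varF : \sum_c book_prob c * (F c - mu) ^+ 2 <= gam ^+ 2.
  under eq_bigr do rewrite Fh expr_div_n mulrA.
  rewrite -mulr_suml prod_pmf_sqr // card_ord.
  set S := \sum_t _; have -> : K%:R * S / K%:R ^+ 2 = S / K%:R by field; rewrite gt_eqF.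
  rewrite ler_pdivrMr // /S.
  apply: le_trans MK; have M0 : 0 <= M.
    case: (pickP T) => [t _|T0]; first exact: le_trans (f0 t) (fM t).
    by move: P1; rewrite big_pred0 // => /esym/eqP; rewrite oner_eq0.
  (* From [f ^+ 2 <= M * f], one entry has variance at most [M * mu - mu ^+ 2], which is at most
     [M]. *)
  apply: (@le_trans _ _ (\sum_t P t * (M * f t - 2 * mu * f t + mu ^+ 2))).
    apply: ler_sum => t _; apply: ler_wpM2l => //; rewrite /h.
    have : f t * f t <= M * f t by rewrite ler_wpM2r.
    rewrite sqrrB expr2 -[_ *+ 2]mulr_natl; lra.
  rewrite (eq_bigr (fun t => M * (P t * f t) - 2 * mu * (P t * f t) + P t * mu ^+ 2)).
    rewrite big_split /= sumrB -!mulr_sumr -mulr_suml P1 -/mu.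
    have : M * mu <= M by rewrite ler_piMr.
    have : 0 <= mu * mu by rewrite mulr_ge0.
    rewrite expr2; lra.
  by move=> t _; ring.
(* A quadratic minorant of [min(1, F)], from [F - mu <= gam / 2 + (F - mu) ^+ 2 / (2 * gam)]. Its
   mean involves only the variance, and the two losses are at most [gam / 2] each. *)
have pt c : F c - gam / 2 - (F c - mu) ^+ 2 / (2 * gam) <= \sum_k book_sel f c k.
  rewrite book_sel_sum -/(F c).
  have key : F c - mu <= gam / 2 + (F c - mu) ^+ 2 / (2 * gam).
    rewrite -subr_ge0.
    have -> : gam / 2 + (F c - mu) ^+ 2 / (2 * gam) - (F c - mu) =
       (F c - mu - gam) ^+ 2 / (2 * gam) by field; rewrite gt_eqF.
    by rewrite divr_ge0 ?sqr_ge0 // mulr_ge0 // ltW.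
  have [F1|F1] := leP (F c) 1.
    rewrite divr1; have : 0 <= (F c - mu) ^+ 2 / (2 * gam).
      by rewrite divr_ge0 ?sqr_ge0 // mulr_ge0 // ltW.
    lra.
  rewrite divff ?gt_eqF // ?(lt_trans ltr01) //; lra.
have : \sum_c book_prob c * (F c - gam / 2 - (F c - mu) ^+ 2 / (2 * gam)) <=
   \sum_c book_prob c * \sum_k book_sel f c k.
  by apply: ler_sum => c _; rewrite ler_wpM2l // book_prob_ge0.
rewrite (eq_bigr (fun c => book_prob c * F c - book_prob c * (gam / 2)
   - (book_prob c * (F c - mu) ^+ 2) / (2 * gam))); last by move=> c _; ring.
rewrite !sumrB -!mulr_suml EF (prod_pmf1 P1) mul1r.
have : (\sum_c book_prob c * (F c - mu) ^+ 2) / (2 * gam) <= gam ^+ 2 / (2 * gam).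
  by rewrite ler_wpM2r // invr_ge0 mulr_ge0 // ltW.
have -> : gam ^+ 2 / (2 * gam) = gam / 2 by field; rewrite gt_eqF.
lra.
Qed.
End random_codebook.
Local Open Scope classical_set_scope.
Local Open Scope ring_scope.
Local Open Scope ereal_scope.

(** * Mixtures, product laws and kernels *)

Section probability_of_measure.
Context d (T : measurableType d) (R : realType) (mu : {measure set T -> \bar R}).

(** The proof of unit mass is a parameter of this alias of [mu] so that a probability structure can
    be inferred for it. *)
Definition unit_mass_measure (muT : mu setT = 1) : set T -> \bar R := mu.

Hypothesis muT : mu setT = 1.
HB.instance Definition _ := Measure.on (unit_mass_measure muT).
HB.instance Definition _ := Measure_isProbability.Build _ _ _ (unit_mass_measure muT) muT.

Lemma probability_of_measure : exists P : probability T R, forall A, P A = mu A.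
Proof. by exists (unit_mass_measure muT). Qed.
End probability_of_measure.

Section kernel_of_measure.
Context d d' (X : measurableType d) (Y : measurableType d') (R : realType).
Variable k : X -> {measure set Y -> \bar R}.

Definition unit_mass_family
    (mk : forall U, measurable U -> measurable_fun [set: X] (fun x => k x U))
    (k1 : forall x, k x setT = 1) : X -> {measure set Y -> \bar R} := k.

Hypothesis mk : forall U, measurable U -> measurable_fun [set: X] (fun x => k x U).
Hypothesis k1 : forall x, k x setT = 1.
HB.instance Definition _ := isKernel.Build _ _ _ _ _ (unit_mass_family mk k1) mk.
HB.instance Definition _ :=
  Kernel_isProbability.Build _ _ _ _ _ (unit_mass_family mk k1) k1.

Lemma kernel_of_measure : exists K : R.-pker X ~> Y, forall x, K x = k x.
Proof. by exists (unit_mass_family mk k1). Qed.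
End kernel_of_measure.

Lemma mixture_probability d (T : measurableType d) (R : realType) (I : finType)
  (w : I -> R) (P : I -> probability T R) :
  (forall i, (0 <= w i)%R) -> (\sum_i w i)%R = 1%R ->
  exists Q : probability T R, (forall A, Q A = \sum_i (w i)%:E * P i A) /\
    forall f : T -> \bar R, (forall x, 0 <= f x) -> measurable_fun setT f ->
      \int[Q]_x f x = \sum_i (w i)%:E * \int[P i]_x f x.
Proof.
move=> w0 w1.
(* [msum] takes a family over [nat]: the index type is enumerated and the rest is padded with
   [mzero]. *)
pose m (k : nat) : {measure set T -> \bar R} :=
  if insub k is Some j then mscale (NngNum (w0 (@enum_val _ predT j))) (P (enum_val j))
  else mzero.
have mE (j : 'I_#|I|) : m j = mscale (NngNum (w0 (enum_val j))) (P (enum_val j)).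
  by rewrite /m valK.
have sE (F : I -> \bar R) : \sum_(j < #|I|) F (enum_val j) = \sum_i F i.
  by rewrite [RHS](big_enum_val F).
have mA A : msum m #|I| A = \sum_i (w i)%:E * P i A.
  by rewrite /msum -sE; apply: eq_bigr => j _; rewrite mE.
have [|Q QE] := @probability_of_measure _ _ R (msum m #|I|).
  rewrite [LHS]mA; under eq_bigr do rewrite probability_setT mule1.
  by rewrite sumEFin w1.
exists Q; split => [A|f f0 mf]; first by rewrite QE [LHS]mA.
rewrite (eq_measure_integral (msum m #|I|)); last by move=> A _ _; exact: QE.
rewrite ge0_integral_measure_sum // -sE; apply: eq_bigr => j _.
by rewrite mE ge0_integral_mscale.
Qed.

Lemma probability_image d d' (T : measurableType d) (T' : measurableType d') (R : realType)
  (P : probability T R) (X : T -> T') : measurable_fun setT X ->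
  exists Q : probability T' R, (forall A, Q A = P (X @^-1` A)) /\
    forall f : T' -> \bar R, measurable_fun setT f -> (forall x, 0 <= f x) ->
      \int[Q]_x f x = \int[P]_w f (X w).
Proof.
move=> mX; pose m := isMeasurableFun.Build _ _ _ _ _ mX.
pose X' : {RV P >-> T'} := HB.pack X m.
exists (distribution P X'); split => // f mf f0.
by rewrite ge0_integral_distribution.
Qed.

(** * Product laws on tuples *)

Section tuple_product.
Context {d} {T : measurableType d} {R : realType}.

Definition box n (A : 'I_n -> set T) : set (n.-tuple T) :=
  [set x | forall i, A i (tnth x i)].

Lemma measurable_box n (A : 'I_n -> set T) :
  (forall i, measurable (A i)) -> measurable (box A).
Proof.
move=> mA; have -> : box A = \bigcap_(i in setT) ((tnth (T:=T))^~ i @^-1` A i).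
  by apply/seteqP; split => x /= h i; [move=> _|]; apply: h.
apply: fin_bigcap_measurable; first exact: finite_finset.
by move=> i _; rewrite -[X in measurable X]setTI; exact: measurable_tnth.
Qed.

(** Boxes are stable under intersection and generate the sigma-algebra of tuples, so they determine
    a finite measure. *)
Lemma tuple_measure_unique n (m1 m2 : {measure set (n.-tuple T) -> \bar R}) :
  m1 setT < +oo ->
  (forall A : 'I_n -> set T, (forall i, measurable (A i)) -> m1 (box A) = m2 (box A)) ->
  forall B, measurable B -> m1 B = m2 B.
Proof.
move=> m1oo m12 B mB.
pose G : set (set (n.-tuple T)) :=
  [set C | exists2 A : 'I_n -> set T, (forall i, measurable (A i)) & C = box A].
have boxT : box (fun=> setT) = setT :> set (n.-tuple T) by apply/seteqP; split.
apply: (measure_unique G (fun=> setT)) => //.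
- apply/seteqP; split.
    apply: smallest_sub; first exact: smallest_sigma_algebra.
    move=> C; rewrite -bigcup_seq => -[i _ [A mA <-]].
    apply: sub_sigma_algebra; exists (fun j => if j == i then A else setT).
      by move=> j; case: ifP.
    rewrite setTI; apply/seteqP; split => x /=.
      by move=> Ax j; case: eqP => // ->.
    by move=> /(_ i); rewrite eqxx.
  apply: smallest_sub; first exact: sigma_algebra_measurable.
  by move=> C [A mA ->]; exact: measurable_box.
- move=> _ _ [A mA ->] [A' mA' ->]; exists (fun i => A i `&` A' i).
    by move=> i; exact: measurableI.
  apply/seteqP; split => x /=; first by move=> [h h'] i; split.
  by move=> h; split => i; have [] := h i.
- by move=> _; exists (fun=> setT).
- by apply/seteqP; split => // x _; exists 0%N.
- by move=> _ [A mA ->]; exact: m12.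
Qed.

Lemma emeasurable_prod_tnth n (g : 'I_n -> T -> \bar R) :
  (forall i, measurable_fun setT (g i)) ->
  measurable_fun setT (fun x : n.-tuple T => \prod_(i < n) g i (tnth x i)).
Proof.
move=> mg; rewrite -[X in measurable_fun _ X](_ :
  (fun x => \prod_(i <- index_enum 'I_n) g i (tnth x i)) = _) //.
elim: (index_enum _) => [|i s IH].
  by under eq_fun do rewrite big_nil; exact: measurable_cst.
under eq_fun do rewrite big_cons; apply: emeasurable_funM => //.
by apply: measurableT_comp => //; exact: measurable_tnth.
Qed.

(** Stated for products of functions because the induction reproduces this form: the law is the
    image of a binary product under [cons], and Tonelli splits off the head. *)
Lemma tuple_product_exists n (Q : 'I_n -> probability T R) :
  exists P : probability (n.-tuple T) R,
  forall g : 'I_n -> T -> \bar R, (forall i, measurable_fun setT (g i)) ->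
    (forall i x, 0 <= g i x) ->
    \int[P]_x \prod_(i < n) g i (tnth x i) = \prod_(i < n) \int[Q i]_x g i x.
Proof.
elim: n Q => [|n IH] Q.
  exists (dirac [tuple] : probability _ _) => g mg g0.
  rewrite big_ord0 (eq_integral (cst 1)); last by move=> x _; rewrite big_ord0.
  by rewrite integral_cst // mul1e; exact: probability_setT.
have [P' P'E] := IH (fun i => Q (lift ord0 i)).
pose cns (p : T * n.-tuple T) : n.+1.-tuple T := [tuple of p.1 :: p.2].
have mcns : measurable_fun setT cns by exact: measurable_cons.
have [P PE] := probability_image (Q ord0 \x P')%E mcns.
exists P => g mg g0.
have mG := emeasurable_prod_tnth mg.
rewrite (PE.2 _ mG); last by move=> y; apply: prode_ge0.
rewrite fubini_tonelli1 //=; last 2 first.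
  - exact: measurableT_comp mG mcns.
  - by move=> x; apply: prode_ge0.
rewrite /fubini_F /= big_ord_recl /=.
under eq_integral => x _.
  under eq_integral => y _.
    rewrite big_ord_recl /= (_ : tnth _ ord0 = x) //.
    under eq_bigr => i _ do rewrite tnthS.
    over.
  rewrite ge0_integralZl //=; last 2 first.
  - exact: (@emeasurable_prod_tnth n (fun i => g (lift ord0 i))).
  - by move=> y _; apply: prode_ge0.
  rewrite (P'E (fun i => g (lift ord0 i))) //.
  over.
by rewrite ge0_integralZr //= prode_ge0 // => i _; exact: integral_ge0.
Qed.

Lemma prod_indic_box n (A : 'I_n -> set T) x :
  \prod_(i < n) (\1_(A i) (tnth x i))%:E = (\1_(box A) x)%:E :> \bar R.
Proof.
rewrite prodEFin; congr EFin; rewrite indicE; have [h|] := pselect (box A x).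
  rewrite mem_set // big1 // => i _; rewrite indicE mem_set //; exact: h.
move=> nA; rewrite (memNset nA); move: nA => /existsNP[i Ai].
by rewrite (bigD1 i) //= indicE memNset // mul0r.
Qed.

Lemma product_integral_box n (Q : 'I_n -> probability T R) (P : probability (n.-tuple T) R) :
  (forall g : 'I_n -> T -> \bar R, (forall i, measurable_fun setT (g i)) ->
    (forall i x, 0 <= g i x) ->
    \int[P]_x \prod_(i < n) g i (tnth x i) = \prod_(i < n) \int[Q i]_x g i x) ->
  forall A : 'I_n -> set T, (forall i, measurable (A i)) ->
     P (box A) = \prod_(i < n) Q i (A i).
Proof.
move=> PE A mA.
rewrite -(setIT (box A)) -integral_indic //; last exact: measurable_box.
under eq_integral do rewrite -prod_indic_box.
rewrite (PE (fun i x => (\1_(A i) x)%:E)) //.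
- by apply: eq_bigr => i _; rewrite integral_indic // setIT.
- by move=> i; apply/measurable_EFinP; exact: measurable_indic.
Qed.

(** [iid_law] prescribes values on boxes only; uniqueness identifies such a law with the constructed
    product, for which the integral formula is known. *)
Lemma integral_prod_tnth n (Q : 'I_n -> probability T R) (P : probability (n.-tuple T) R) :
  (forall A : 'I_n -> set T, (forall i, measurable (A i)) ->
     P (box A) = \prod_(i < n) Q i (A i)) ->
  forall g : 'I_n -> T -> \bar R, (forall i, measurable_fun setT (g i)) ->
    (forall i x, 0 <= g i x) ->
    \int[P]_x \prod_(i < n) g i (tnth x i) = \prod_(i < n) \int[Q i]_x g i x.
Proof.
move=> PA g mg g0; have [P' P'E] := tuple_product_exists Q.
rewrite -P'E //; apply: eq_measure_integral => B mB _.
apply: tuple_measure_unique => // [|A mA]; first by rewrite -ge0_fin_numE //; exact: fin_num_measure.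
transitivity (\prod_(i < n) Q i (A i)); first exact: PA.
by apply/esym; exact: product_integral_box.
Qed.

Lemma tuple_product_box n (Q : 'I_n -> probability T R) :
  exists P : probability (n.-tuple T) R, forall A : 'I_n -> set T,
    (forall i, measurable (A i)) -> P (box A) = \prod_(i < n) Q i (A i).
Proof.
have [P PE] := tuple_product_exists Q; exists P => A mA.
exact: product_integral_box.
Qed.

Lemma integral_tnth n (Q : 'I_n -> probability T R) (P : probability (n.-tuple T) R) :
  (forall A : 'I_n -> set T, (forall i, measurable (A i)) ->
     P (box A) = \prod_(i < n) Q i (A i)) ->
  forall (t : 'I_n) (g : T -> \bar R), measurable_fun setT g -> (forall x, 0 <= g x) ->
    \int[P]_x g (tnth x t) = \int[Q t]_x g x.
Proof.
move=> PA t g mg g0.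
have := integral_prod_tnth PA (g := fun i => if i == t then g else cst 1).
rewrite (bigD1 t) //= eqxx [X in _ * X]big1 ?mule1; last first.
  by move=> i /negbTE ->; rewrite integral_cst // mul1e; exact: probability_setT.
move=> <-.
- by apply: eq_integral => x _; rewrite (bigD1 t) //= eqxx big1 ?mule1 // => i /negbTE ->.
- by move=> i; case: ifP.
- by move=> i x; case: ifP.
Qed.

End tuple_product.

(** * Operations on probability kernels *)

Section kernel_operations.
Context {R : realType}.

Lemma kernel_precomp d1 d2 d3 (X : measurableType d1) (Y : measurableType d2)
  (Z : measurableType d3) (k : R.-pker Y ~> Z) (h : X -> Y) : measurable_fun setT h ->
  exists K : R.-pker X ~> Z, forall x, K x = k (h x).
Proof.
move=> mh; apply: (@kernel_of_measure _ _ _ _ _ (fun x => k (h x))) => [U mU|x].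
  exact: measurableT_comp (measurable_kernel k U mU) mh.
exact: prob_kernel.
Qed.

Lemma kernel_bind d1 d2 d3 (X : measurableType d1) (Y : measurableType d2)
  (Z : measurableType d3) (l : R.-pker X ~> Y) (k : R.-pker (X * Y) ~> Z) :
  exists K : R.-pker X ~> Z, forall x,
    (forall U, K x U = \int[l x]_y k (x, y) U) /\
    forall f : Z -> \bar R, measurable_fun setT f -> (forall z, 0 <= f z) ->
      \int[K x]_z f z = \int[l x]_y \int[k (x, y)]_z f z.
Proof.
have [K KE] : exists K : R.-pker X ~> Z, forall x, K x = (l \; k) x.
  apply: kernel_of_measure => [U mU|x]; first exact: measurable_kernel.
  rewrite /= /kcomp; under eq_integral do rewrite prob_kernel.
  by rewrite integral_cst //= mul1e prob_kernel.
exists K => x; split => [U|f mf f0]; first by rewrite KE.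
rewrite KE; exact: (@integral_kcomp _ _ _ _ _ _ R l k x f f0 mf).
Qed.

Lemma kernel_image d1 d2 d3 (X : measurableType d1) (Y : measurableType d2)
  (Z : measurableType d3) (k : R.-pker X ~> Y) (h : Y -> Z) : measurable_fun setT h ->
  exists K : R.-pker X ~> Z, forall x,
    (forall U, measurable U -> K x U = k x (h @^-1` U)) /\
    forall f : Z -> \bar R, measurable_fun setT f -> (forall z, 0 <= f z) ->
      \int[K x]_z f z = \int[k x]_y f (h y).
Proof.
move=> mh; have mh2 : measurable_fun setT (fun p : X * Y => h p.2).
  exact: measurableT_comp.
have [K KE] := kernel_bind k (kdirac mh2).
exists K => x; split => [U mU|f mf f0].
  rewrite (KE x).1 (eq_integral (fun y => (\1_(h @^-1` U) y)%:E)) //.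
  by rewrite integral_indic ?setIT // -[X in measurable X]setTI; exact: mh.
rewrite (KE x).2 //; apply: eq_integral => y _.
by rewrite integral_dirac // diracT mul1e.
Qed.

Lemma kernel_mixture d1 d2 (X : measurableType d1) (Y : measurableType d2) (I : finType)
  (w : I -> R) (k : I -> R.-pker X ~> Y) :
  (forall i, (0 <= w i)%R) -> (\sum_i w i)%R = 1%R ->
  exists K : R.-pker X ~> Y, forall x,
    (forall U, measurable U -> K x U = \sum_i (w i)%:E * k i x U) /\
    forall f : Y -> \bar R, measurable_fun setT f -> (forall y, 0 <= f y) ->
      \int[K x]_y f y = \sum_i (w i)%:E * \int[k i x]_y f y.
Proof.
move=> w0 w1.
have prb i x : exists P : probability Y R, forall A, P A = k i x A.
  by apply: probability_of_measure; exact: prob_kernel.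
(* The laws are mixed separately at each [x]; measurability in [x] is recovered afterwards from the
   explicit finite sum. *)
have /choice[Q QE] x : exists Q : probability Y R,
    (forall A, Q A = \sum_i (w i)%:E * k i x A) /\
    forall f : Y -> \bar R, (forall y, 0 <= f y) -> measurable_fun setT f ->
      \int[Q]_y f y = \sum_i (w i)%:E * \int[k i x]_y f y.
  have /choice[P PE] : forall i, exists P : probability Y R, forall A, P A = k i x A.
    by move=> i; exact: prb.
  have [Q [Q1 Q2]] := mixture_probability P w0 w1.
  exists Q; split => [A|f f0 mf]; first by rewrite Q1; apply: eq_bigr => i _; rewrite PE.
  rewrite Q2 //; apply: eq_bigr => i _; congr (_ * _).
  by apply: eq_measure_integral => A _ _; exact: PE.
have [K KE] : exists K : R.-pker X ~> Y, forall x, K x = Q x.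
  apply: (@kernel_of_measure _ _ _ _ _ (fun x => Q x)) => [U mU|x].
    rewrite (_ : (fun x => _) = fun x => \sum_i (w i)%:E * k i x U); last first.
      by apply/funext => x; exact: (QE x).1.
    apply: emeasurable_sum => i; apply: measurable_funeM.
    exact: measurable_kernel.
  exact: probability_setT.
exists K => x; split => [U _|f mf f0]; first by rewrite KE; exact: (QE x).1.
by rewrite KE; exact: (QE x).2.
Qed.

Lemma kernel_cst d1 d2 (X : measurableType d1) (Y : measurableType d2)
  (P : probability Y R) :
  exists K : R.-pker X ~> Y, forall x, K x = P.
Proof.
apply: (@kernel_of_measure _ _ _ _ _ (fun x : X => P)) => [U mU|x].
  exact: measurable_cst.
exact: probability_setT.
Qed.

Lemma measurable_fun_integral_pker d1 d2 (X : measurableType d1) (Y : measurableType d2)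
  (k : R.-pker X ~> Y) (f : X -> Y -> \bar R) :
  measurable_fun setT (fun p : X * Y => f p.1 p.2) -> (forall x y, 0 <= f x y) ->
  measurable_fun setT (fun x => \int[k x]_y f x y).
Proof.
move=> mf f0.
exact: (measurable_fun_integral_finite_kernel (fun p => f p.1 p.2) k).
Qed.

Lemma integral_nat (mu : {measure set nat -> \bar R}) (f : nat -> \bar R) :
  (forall z, 0 <= f z) -> \int[mu]_z f z = \sum_(0 <= z <oo) f z * mu [set z].
Proof.
move=> f0.
have UT : \bigcup_z [set z] = [set: nat] by apply/seteqP; split => // z _; exists z.
rewrite -[in LHS]UT ge0_integral_bigcup //.
- apply: eq_eseriesr => z _.
  rewrite (eq_integral (cst (f z))); last by move=> y; rewrite inE /= => ->.
  by rewrite integral_cst.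
- by move=> i j _ _ [x [-> ->]].
Qed.

End kernel_operations.

(** * Converse *)

Section averaged_kernel.
Context {R : realType} {d} {X : measurableType d} (PX : probability X R) (n : nat).
Variable Pn : probability (n.-tuple X) R.
Hypothesis iidPn : iid_law PX Pn.

(** Overwriting coordinate [t] of an independent block by [x] realises the law of the block given
    [X_t = x], at every [x] and without disintegration. *)
Definition set_coord (t : 'I_n) (p : X * n.-tuple X) : n.-tuple X :=
  [tuple if i == t then p.1 else tnth p.2 i | i < n].

Lemma measurable_set_coord t : measurable_fun setT (set_coord t).
Proof.
apply/measurable_fun_tnthP => i.
rewrite (_ : _ \o _ = if i == t then fst else (tnth (T:=X))^~ i \o snd).
  by case: ifP => _ //; apply: measurableT_comp => //; exact: measurable_tnth.
by apply/funext => p /=; rewrite tnth_mktuple; case: ifP.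
Qed.

Lemma tnth_set_coord t p : tnth (set_coord t p) t = p.1.
Proof. by rewrite tnth_mktuple eqxx. Qed.

(** Resampling one coordinate preserves an i.i.d. law, as is seen on boxes. *)
Lemma integral_set_coord t (h : n.-tuple X -> \bar R) :
  measurable_fun setT h -> (forall u, 0 <= h u) ->
  \int[PX]_x \int[Pn]_u h (set_coord t (x, u)) = \int[Pn]_u h u.
Proof.
move=> mh h0.
have [Q [QA Qf]] := probability_image (PX \x Pn)%E (measurable_set_coord t).
transitivity (\int[Q]_u h u).
  rewrite Qf // fubini_tonelli1 //=.
  exact: measurableT_comp mh (measurable_set_coord t).
apply: eq_measure_integral => B mB _.
apply: tuple_measure_unique => // [|A mA]; first by rewrite -ge0_fin_numE //; exact: fin_num_measure.
transitivity (\prod_(i < n) PX (A i)); last by apply/esym; exact: iidPn.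
transitivity ((PX \x Pn)%E (set_coord t @^-1` box A)); first exact: QA.
rewrite (_ : _ @^-1` _ = A t `*` box (fun i => if i == t then setT else A i)); last first.
  apply/seteqP; split => -[x u] /=.
    move=> hA; split; first by have := hA t; rewrite tnth_set_coord.
    by move=> i; have := hA i; rewrite tnth_mktuple; case: ifP.
  by move=> [h1 h2] i; rewrite tnth_mktuple /=; case: eqP => [->//|it]; have := h2 i; case: eqP.
rewrite product_measure1E //; last first.
  by apply: measurable_box => i; case: ifP.
rewrite (bigD1 t) //=; congr (_ * _).
have := iidPn (A := fun i => if i == t then setT else A i).
move=> -> //; last by move=> i; case: ifP.
rewrite (bigD1 t) //= eqxx probability_setT mul1e.
by apply: eq_bigr => i /negbTE ->.
Qed.

Variables (enc : R.-pker (n.-tuple X) ~> nat) (dec : R.-pker nat ~> n.-tuple X).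
Hypothesis n0 : (0 < n)%N.

Lemma measurable_preimage_tnth (t : 'I_n) (U : set X) :
  measurable U -> measurable [set y : n.-tuple X | U (tnth y t)].
Proof. by move=> mU; rewrite -[X in measurable X]setTI; exact: measurable_tnth. Qed.

(** The kernel draws [t] uniformly, plants [x] at place [t] of a fresh block, runs the code and
    returns letter [t]. The formula for sets serves the information and the one for integrals the
    distortion. *)
Lemma averaged_kernel_exists : exists K : R.-pker X ~> X, forall x,
  (forall U, measurable U -> K x U = \sum_(t < n) (n%:R^-1)%:E *
     \int[Pn]_u \int[enc (set_coord t (x, u))]_z dec z [set y | U (tnth y t)]) /\
  forall f : X -> \bar R, measurable_fun setT f -> (forall y, 0 <= f y) ->
    \int[K x]_y f y = \sum_(t < n) (n%:R^-1)%:E *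
     \int[Pn]_u \int[enc (set_coord t (x, u))]_z \int[dec z]_y f (tnth y t).
Proof.
have [d2 d2E] := kernel_precomp dec (@measurable_snd _ _ (n.-tuple X) nat).
have [C CE] := kernel_bind enc d2.
have [P PE] := kernel_cst X Pn.
have /choice[Kt KtE] : forall t : 'I_n, exists K : R.-pker X ~> X, forall x,
  (forall U, measurable U -> K x U =
     \int[Pn]_u \int[enc (set_coord t (x, u))]_z dec z [set y | U (tnth y t)]) /\
  forall f : X -> \bar R, measurable_fun setT f -> (forall y, 0 <= f y) ->
    \int[K x]_y f y =
     \int[Pn]_u \int[enc (set_coord t (x, u))]_z \int[dec z]_y f (tnth y t).
  move=> t; have [C2 C2E] := kernel_precomp C (measurable_set_coord t).
  have [B BE] := kernel_bind P C2.
  have [K KE] := kernel_image B (@measurable_tnth _ X n t).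
  exists K => x; split => [U mU|f mf f0].
    rewrite (KE x).1 // (BE x).1 PE; apply: eq_integral => u _.
    rewrite C2E (CE _).1; apply: eq_integral => z _.
    by rewrite d2E.
  rewrite (KE x).2 // (BE x).2 //; last first.
    by apply: measurableT_comp => //; exact: measurable_tnth.
  rewrite PE; apply: eq_integral => u _.
  rewrite C2E (CE _).2 //; last first.
    by apply: measurableT_comp => //; exact: measurable_tnth.
  by apply: eq_integral => z _; rewrite d2E.
have [||K KE] := @kernel_mixture R _ _ X X 'I_n (fun=> n%:R^-1)%R Kt.
- by move=> _; rewrite invr_ge0.
- rewrite sumr_const card_ord -[(_ *+ n)%R]mulr_natr mulVf //.
  by rewrite pnatr_eq0 -lt0n.
exists K => x; split => [U mU|f mf f0].
  by rewrite (KE x).1 //; apply: eq_bigr => t _; rewrite (KtE t x).1.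
by rewrite (KE x).2 //; apply: eq_bigr => t _; rewrite (KtE t x).2.
Qed.

Definition pair_law (t : 'I_n) (A B : set X) : \bar R :=
  \int[Pn]_u ((\1_A (tnth u t))%:E * \int[enc u]_z dec z [set y | B (tnth y t)]).

Lemma measurable_code_law t B : measurable B ->
  measurable_fun setT (fun u => \int[enc u]_z dec z [set y | B (tnth y t)]).
Proof.
move=> mB; apply: (@measurable_fun_integral_pker _ _ _ _ _ enc
  (fun _ z => dec z [set y | B (tnth y t)])) => //.
exact: (measurableT_comp (measurable_kernel dec _ (measurable_preimage_tnth t mB)) measurable_snd).
Qed.

Section averaged_kernel_spec.
Variable K : R.-pker X ~> X.
Hypothesis KE : forall x,
  (forall U, measurable U -> K x U = \sum_(t < n) (n%:R^-1)%:E *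
     \int[Pn]_u \int[enc (set_coord t (x, u))]_z dec z [set y | U (tnth y t)]) /\
  forall f : X -> \bar R, measurable_fun setT f -> (forall y, 0 <= f y) ->
    \int[K x]_y f y = \sum_(t < n) (n%:R^-1)%:E *
     \int[Pn]_u \int[enc (set_coord t (x, u))]_z \int[dec z]_y f (tnth y t).

Let nV0 : 0 <= (n%:R^-1)%:E :> \bar R. Proof. by rewrite lee_fin invr_ge0. Qed.

(** Coordinate [t] of the planted block is [x], so the indicator of [A] can be moved under the
    integral over blocks; integrating over [x] then undoes the planting. *)
Lemma averaged_joint_law A B : measurable A -> measurable B ->
  joint_law PX K (A `*` B) = \sum_(t < n) (n%:R^-1)%:E * pair_law t A B.
Proof.
move=> mA mB; rewrite /joint_law.
pose F t (u : n.-tuple X) := (\1_A (tnth u t))%:E * \int[enc u]_z dec z [set y | B (tnth y t)].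
have F0 t u : 0 <= F t u.
  by apply: mule_ge0; [rewrite lee_fin|apply: integral_ge0].
have mF t : measurable_fun setT (F t).
  apply: emeasurable_funM; last exact: measurable_code_law.
  by apply/measurable_EFinP/measurableT_comp => //; exact: measurable_tnth.
have mFs t : measurable_fun setT (fun x => \int[Pn]_u F t (set_coord t (x, u))).
  apply: (@measurable_fun_fubini_tonelli_F _ _ X _ R Pn (F t \o set_coord t)) => [|p].
    exact: measurableT_comp (mF t) (measurable_set_coord t).
  exact: F0.
transitivity (\int[PX]_x \sum_(t < n) (n%:R^-1)%:E * \int[Pn]_u F t (set_coord t (x, u))).
  apply: eq_integral => x _.
  have [xA|xA] := pselect (A x).
    rewrite (_ : [set y | _] = B); last by apply/seteqP; split => y /=; [case|].
    rewrite (KE x).1 //; apply: eq_bigr => t _; congr (_ * _).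
    by apply: eq_integral => u _; rewrite /F tnth_set_coord /= indicE mem_set // mul1e.
  rewrite (_ : [set y | _] = set0); last by apply/seteqP; split => y //= -[].
  rewrite measure0 big1 // => t _; rewrite integral0_eq ?mule0 // => u _.
  by rewrite /F tnth_set_coord /= indicE memNset // mul0e.
rewrite ge0_integral_sum //; last 2 first.
  - by move=> t; exact: measurable_funeM.
  - by move=> t x _; apply: mule_ge0 => //; exact: integral_ge0.
apply: eq_bigr => t _; rewrite ge0_integralZl //; last by move=> x _; exact: integral_ge0.
by rewrite integral_set_coord.
Qed.

Lemma averaged_distortion (Delta : X -> X -> R) :
  measurable_fun setT (fun p : X * X => Delta p.1 p.2) -> (forall x y, (0 <= Delta x y)%R) ->
  exp_distortion PX Delta K = code_avg_distortion Delta Pn enc dec.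
Proof.
move=> mD D0; rewrite /exp_distortion /code_avg_distortion.
pose F t (u : n.-tuple X) :=
  \int[enc u]_z \int[dec z]_y (Delta (tnth u t) (tnth y t))%:E.
have F0 t u : 0 <= F t u.
  by apply: integral_ge0 => z _; apply: integral_ge0 => y _; rewrite lee_fin.
have [d2 d2E] := kernel_precomp dec (@measurable_snd _ _ (n.-tuple X) nat).
have mF t : measurable_fun setT (F t).
  apply: (@measurable_fun_integral_pker _ _ _ _ _ enc
    (fun u z => \int[dec z]_y (Delta (tnth u t) (tnth y t))%:E)) => [|u z]; last first.
    by apply: integral_ge0 => y _; rewrite lee_fin.
  rewrite (_ : (fun p => _) = fun p : n.-tuple X * nat =>
     \int[d2 p]_y (Delta (tnth p.1 t) (tnth y t))%:E); last by apply/funext => p; rewrite d2E.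
  apply: measurable_fun_integral_pker => [|p y]; last by rewrite lee_fin.
  apply/measurable_EFinP.
  have mp : measurable_fun setT (fun q : (n.-tuple X * nat) * n.-tuple X =>
      (tnth q.1.1 t, tnth q.2 t)).
    apply: measurable_fun_pair => /=.
      apply: (measurableT_comp (measurable_tnth t)).
      exact: (measurableT_comp measurable_fst measurable_fst).
    exact: (measurableT_comp (measurable_tnth t)).
  exact: (measurableT_comp mD mp).
have mFs t : measurable_fun setT (fun x => \int[Pn]_u F t (set_coord t (x, u))).
  apply: (@measurable_fun_fubini_tonelli_F _ _ X _ R Pn (F t \o set_coord t)) => [|p].
    exact: measurableT_comp (mF t) (measurable_set_coord t).
  exact: F0.
transitivity (\int[PX]_x \sum_(t < n) (n%:R^-1)%:E * \int[Pn]_u F t (set_coord t (x, u))).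
  apply: eq_integral => x _.
  have mDx : measurable_fun setT (fun y => (Delta x y)%:E).
    by apply/measurable_EFinP; exact: (measurableT_comp mD (pair1_measurable x)).
  have Dx0 y : 0 <= (Delta x y)%:E by rewrite lee_fin.
  apply: (etrans ((KE x).2 _ mDx Dx0)).
  apply: eq_bigr => t _; apply: (congr1 (fun a => (n%:R^-1)%:E * a)).
  by apply: eq_integral => u _; rewrite /F tnth_set_coord.
rewrite ge0_integral_sum //; last 2 first.
  - by move=> t; exact: measurable_funeM.
  - by move=> t x _; apply: mule_ge0 => //; exact: integral_ge0.
rewrite ge0_sume_distrr; last by move=> t _; apply: integral_ge0 => u _; exact: F0.
apply: eq_bigr => t _; rewrite ge0_integralZl //; last by move=> x _; exact: integral_ge0.
by rewrite integral_set_coord.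
Qed.

End averaged_kernel_spec.
End averaged_kernel.

(** * Information carried by one codeword, and by a code *)

Section word_information.
Import numFieldNormedType.Exports.
Local Open Scope ring_scope.
Context {R : realType} (n m k : nat).

(* The only information inequality of the converse: apply [1 + ln x <= x] to
   [x = p * \prod_t q_t], where [q_t] is the single-letter information density. *)
Lemma word_information (e : {ffun 'I_n -> 'I_m} -> R) (D : {ffun 'I_n -> 'I_k} -> R)
  (pb : 'I_m -> 'I_k -> R) (a : 'I_m -> R) (b : 'I_k -> R) (p : R) :
  (forall i, 0 <= e i) -> (forall j, 0 <= D j) -> \sum_j D j = 1 -> \sum_i e i = p ->
  (forall i, e i <= \prod_t a (i t)) -> (forall i j, 0 <= pb i j) ->
  (forall i, \sum_j pb i j = a i) -> (forall j, \sum_i pb i j = b j) ->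
  (forall i j t, 0 < e i * D j -> 0 < pb (i t) (j t)) ->
  \sum_i \sum_j e i * D j * \sum_t ln (pb (i t) (j t) / (a (i t) * b (j t))) <= - (p * ln p).
Proof.
move=> e0 D0 D1 ep ea pb0 pba pbb ac.
have p0 : 0 <= p by rewrite -ep sumr_ge0.
pose q x y := pb x y / (a x * b y).
have a0 x : 0 <= a x by rewrite -pba sumr_ge0.
have b0 y : 0 <= b y by rewrite -pbb sumr_ge0.
have q0 x y : 0 <= q x y by rewrite divr_ge0 // mulr_ge0.
have qp x y : 0 < pb x y -> 0 < q x y.
  move=> pxy; rewrite divr_gt0 // mulr_gt0 //.
    by apply: lt_le_trans pxy _; rewrite -pba (bigD1 y) //= lerDl sumr_ge0.
  by apply: lt_le_trans pxy _; rewrite -pbb (bigD1 x) //= lerDl sumr_ge0.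
(* A codeword of probability zero is set aside so that [expR (ln p) = p] can be used below. *)
have [pz|pn] := eqVneq p 0.
  have ez i : e i = 0.
    have /eqP := ep; rewrite pz psumr_eq0 // => /allP/(_ i).
    by rewrite mem_index_enum => /(_ isT)/eqP.
  rewrite pz mul0r oppr0 big1 // => i _.
  by rewrite big1 // => j _; rewrite ez !mul0r.
have pp : 0 < p by rewrite lt_neqAle eq_sym pn.
apply: (@le_trans _ _ (\sum_i \sum_j e i * D j *
    (p * (\prod_t q (i t) (j t)) - (1 + ln p)))).
  apply: ler_sum => i _; apply: ler_sum => j _.
  have [->|eDn] := eqVneq (e i * D j) 0; first by rewrite !mul0r.
  have eDp : 0 < e i * D j by rewrite lt_neqAle eq_sym eDn mulr_ge0.
  rewrite ler_pM2l //.
  have -> : \prod_t q (i t) (j t) = expR (\sum_t ln (q (i t) (j t))).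
    by rewrite expR_sum; apply: eq_bigr => t _; rewrite lnK // posrE; exact/qp/ac.
  rewrite -/q -{1}(@lnK _ p) ?posrE // -expRD.
  have := expR_ge1Dx (ln p + \sum_t ln (q (i t) (j t))).
  rewrite -/(q _ _); lra.
have -> : \sum_i \sum_j e i * D j * (p * (\prod_t q (i t) (j t)) - (1 + ln p)) =
   p * (\sum_j D j * \sum_i e i * \prod_t q (i t) (j t)) - p * (1 + ln p).
  rewrite (eq_bigr (fun i => \sum_j (p * (D j * (e i * \prod_t q (i t) (j t)))
       - e i * (1 + ln p) * D j))); last first.
    by move=> i _; apply: eq_bigr => j _; ring.
  under eq_bigr do rewrite sumrB -!mulr_sumr D1 mulr1.
  rewrite sumrB -mulr_suml ep -mulr_sumr; congr (_ - _); congr (_ * _).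
  rewrite exchange_big /=; apply: eq_bigr => j _; by rewrite mulr_sumr.
(* Since [e] is dominated by the product of the [a], the sum over words factors over coordinates;
   each factor is at most [\sum_x pb x y / b y], which is 1, or 0 when [b y] vanishes. *)
have : \sum_j D j * \sum_i e i * \prod_t q (i t) (j t) <= 1.
  rewrite -[leRHS]D1; apply: ler_sum => j _; rewrite ler_piMr //.
  apply: (@le_trans _ _ (\sum_(i : {ffun 'I_n -> 'I_m}) \prod_t (a (i t) * q (i t) (j t)))).
    apply: ler_sum => i _.
    have -> : \prod_t (a (i t) * q (i t) (j t)) = (\prod_t a (i t)) * \prod_t q (i t) (j t).
      exact: big_split.
    by apply: ler_wpM2r => //; apply: prodr_ge0.
  rewrite -(bigA_distr_bigA (fun t x => a x * q x (j t))) /=.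
  apply: prodr_ile1 => t _; apply/andP; split.
    by apply: sumr_ge0 => x _; rewrite mulr_ge0.
  apply: (@le_trans _ _ (\sum_x pb x (j t) / b (j t))).
    apply: ler_sum => x _; have [->|an] := eqVneq (a x) 0.
      by rewrite mul0r divr_ge0.
    by rewrite /q invfM mulrCA mulVKf.
  rewrite -mulr_suml pbb; have [->|bn] := eqVneq (b (j t)) 0; first by rewrite mul0r.
  by rewrite divff.
move=> h; have : p * (\sum_j D j * \sum_i e i * \prod_t q (i t) (j t)) <= p * 1.
  by rewrite ler_wpM2l.
rewrite mulrDr mulr1; lra.
Qed.

Lemma cvg_finite_sum (I : finType) (f : I -> nat -> R) (l : I -> R) :
  (forall i, f i @ \oo --> l i) -> (fun N => \sum_i f i N) @ \oo --> \sum_i l i.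
Proof.
move=> fl; elim: (index_enum I) => [|i s IH].
  rewrite big_nil; under eq_fun do rewrite big_nil; exact: cvg_cst.
rewrite big_cons; under eq_fun do rewrite big_cons; exact: cvgD.
Qed.

Lemma cvg_partial_sums (T : nat -> R) (l : R) : (forall z, 0 <= T z) ->
  (\sum_(0 <= z <oo) (T z)%:E = l%:E)%E -> (fun N => \sum_(z < N) T z) @ \oo --> l.
Proof.
move=> T0 Tl.
have := @is_cvg_nneseries R (fun z => (T z)%:E) predT 0%N.
move=> /(_ (fun _ _ _ => T0 _)); rewrite Tl => /fine_cvg.
apply: cvg_trans; apply: near_eq_cvg; near=> N.
by rewrite /= sumEFin /= big_mkord.
Unshelve. all: by end_near.
Qed.

(** Sums [word_information] over the codewords. The single-letter logarithms have both signs, so the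
    countable sum is reached as a limit of real partial sums, each of them at most [h]. *)
Lemma code_information (e : nat -> {ffun 'I_n -> 'I_m} -> R)
  (D : nat -> {ffun 'I_n -> 'I_k} -> R) (Pt : 'I_n -> 'I_m -> 'I_k -> R)
  (a : 'I_m -> R) (b : 'I_k -> R) (p : nat -> R) (h : R) :
  (0 < n)%N ->
  (forall z i, 0 <= e z i) -> (forall z j, 0 <= D z j) ->
  (forall z, \sum_j D z j = 1) -> (forall z, \sum_i e z i = p z) -> (forall z, p z <= 1) ->
  (forall z i, e z i <= \prod_t a (i t)) ->
  (forall t x y, \sum_(0 <= z <oo) ((\sum_(i : {ffun 'I_n -> 'I_m} | i t == x) e z i) *
      (\sum_(j : {ffun 'I_n -> 'I_k} | j t == y) D z j))%:E = (Pt t x y)%:E)%E ->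
  let pb x y := n%:R^-1 * \sum_t Pt t x y in
  (forall i, \sum_j pb i j = a i) -> (forall j, \sum_i pb i j = b j) ->
  (\sum_(0 <= z <oo) (- (p z * ln (p z)))%:E <= h%:E)%E ->
  n%:R * (\sum_x \sum_y pb x y * ln (pb x y / (a x * b y))) <= h.
Proof.
move=> n0 e0 D0 D1 ep p1 ea PtE pb pba pbb hp.
pose T t x y z := (\sum_(i : {ffun 'I_n -> 'I_m} | i t == x) e z i) *
  (\sum_(j : {ffun 'I_n -> 'I_k} | j t == y) D z j).
have T0 t x y z : 0 <= T t x y z by rewrite mulr_ge0 // sumr_ge0.
have TPt t x y z : T t x y z <= Pt t x y.
  rewrite -lee_fin -PtE; apply: le_trans (nneseries_lim_ge z.+1 _); last first.
    by move=> z' _ _; rewrite lee_fin; exact: T0.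
  rewrite big_mkord sumEFin lee_fin (bigD1 ord_max) //= lerDl.
  by apply: sumr_ge0 => i _; exact: T0.
have Pt0 t x y : 0 <= Pt t x y by apply: le_trans (T0 t x y 0%N) (TPt t x y 0%N).
have n0R : 0 < n%:R :> R by rewrite ltr0n.
have pb0 x y : 0 <= pb x y by apply: mulr_ge0; rewrite ?sumr_ge0 // invr_ge0 ltW.
pose lq x y := ln (pb x y / (a x * b y)).
have p0 z : 0 <= p z by rewrite -ep sumr_ge0.
have a0 x : 0 <= a x by rewrite -pba sumr_ge0.
(* Absolute continuity: word pairs of positive mass have positive averaged mass at each pair of
   letters, so the logarithms are taken at positive arguments. *)
have ac z i j t : 0 < e z i * D z j -> 0 < pb (i t) (j t).
  move=> eD; rewrite mulr_gt0 ?invr_gt0 //.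
  apply: lt_le_trans (_ : Pt t (i t) (j t) <= _); last by rewrite (bigD1 t) //= lerDl sumr_ge0.
  apply: lt_le_trans eD _; apply: le_trans (TPt t (i t) (j t) z).
  apply: ler_pM => //.
    by rewrite (bigD1 i) //= lerDl sumr_ge0.
  by rewrite (bigD1 j) //= lerDl sumr_ge0.
have wordz z := word_information (e0 z) (D0 z) (D1 z) (ep z) (ea z) pb0 pba pbb (ac z).
(* Sorting the word pairs by their letters at place [t] leaves single-letter sums. *)
have reorg z : \sum_i \sum_j e z i * D z j * \sum_t lq (i t) (j t) =
   \sum_t \sum_x \sum_y lq x y * T t x y z.
  rewrite (eq_bigr (fun i => \sum_t \sum_j e z i * D z j * lq (i t) (j t))); last first.
    by move=> i _; rewrite exchange_big; apply: eq_bigr => j _; rewrite mulr_sumr.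
  rewrite exchange_big; apply: eq_bigr => t _.
  rewrite (partition_big (fun i : {ffun 'I_n -> 'I_m} => i t) predT) //=.
  apply: eq_bigr => x _; rewrite exchange_big /=.
  rewrite (partition_big (fun j : {ffun 'I_n -> 'I_k} => j t) predT) //=.
  apply: eq_bigr => y _; rewrite /T mulrC big_distrlr /= mulr_suml exchange_big /=.
  apply: eq_bigr => i /eqP <-; rewrite mulr_suml; apply: eq_bigr => j /eqP <-.
  by [].
have part N : \sum_t \sum_x \sum_y lq x y * (\sum_(z < N) T t x y z) <= h.
  have -> : \sum_t \sum_x \sum_y lq x y * (\sum_(z < N) T t x y z) =
     \sum_(z < N) \sum_i \sum_j e z i * D z j * \sum_t lq (i t) (j t).
    under [RHS]eq_bigr do rewrite reorg.
    rewrite [RHS]exchange_big; apply: eq_bigr => t _.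
    rewrite [RHS]exchange_big; apply: eq_bigr => x _.
    rewrite [RHS]exchange_big; apply: eq_bigr => y _.
    by rewrite mulr_sumr.
  apply: (@le_trans _ _ (\sum_(z < N) - (p z * ln (p z)))).
    by apply: ler_sum => z _; exact: wordz.
  rewrite -lee_fin; apply: le_trans hp; rewrite -sumEFin.
  rewrite -(big_mkord predT (fun z => (- (p z * ln (p z)))%:E)).
  apply: nneseries_lim_ge => z _ _; rewrite lee_fin oppr_ge0 mulr_ge0_le0 //.
  exact: ln_le0.
have cv : (fun N => \sum_t \sum_x \sum_y lq x y * (\sum_(z < N) T t x y z)) @ \oo -->
    \sum_t \sum_x \sum_y lq x y * Pt t x y.
  apply: (@cvg_finite_sum _ (fun t N => \sum_x \sum_y lq x y * (\sum_(z < N) T t x y z))) => t.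
  apply: (@cvg_finite_sum _ (fun x N => \sum_y lq x y * (\sum_(z < N) T t x y z))) => x.
  apply: (@cvg_finite_sum _ (fun y N => lq x y * (\sum_(z < N) T t x y z))) => y.
  by apply: cvgMr; apply: cvg_partial_sums => //; exact: PtE.
have -> : n%:R * (\sum_x \sum_y pb x y * ln (pb x y / (a x * b y))) =
    \sum_t \sum_x \sum_y lq x y * Pt t x y.
  rewrite mulr_sumr [RHS]exchange_big; apply: eq_bigr => x _.
  rewrite mulr_sumr [RHS]exchange_big; apply: eq_bigr => y _.
  by rewrite /pb -mulr_sumr -/(lq x y) !mulrA mulfV ?gt_eqF // mul1r mulrC.
rewrite -(cvg_lim _ cv) //; apply: limr_le; first by apply/cvg_ex; eexists; exact: cv.
by near=> N; exact: part.
Unshelve. all: by end_near.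
Qed.
End word_information.

Lemma mpartition_indic {R : realType} d (T : measurableType d) m (A : 'I_m -> set T) x :
  finite_mpartition A -> (\sum_i \1_(A i) x)%R = 1%R :> R.
Proof.
move=> [mA dA cA].
have [i Ai] : exists i, A i x.
  have : setT x by []; rewrite -cA -bigcup_seq => -[i _ Aix]; by exists i.
rewrite (bigD1 i) //= indicE mem_set // big1 ?addr0 // => j ji.
rewrite indicE memNset // => Aj.
by have : (A i `&` A j) x; [split|rewrite dA // eq_sym].
Qed.

Lemma mpartition_measure {R : realType} d (T : measurableType d)
  (mu : {measure set T -> \bar R}) m (A : 'I_m -> set T) :
  finite_mpartition A -> \sum_i mu (A i) = mu setT.
Proof.
move=> pA; have [mA _ _] := pA.
transitivity (\int[mu]_x \sum_i (\1_(A i) x)%:E).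
  rewrite ge0_integral_sum //; first by apply: eq_bigr => i _; rewrite integral_indic // setIT.
  by move=> i; apply/measurable_EFinP; exact: measurable_indic.
under eq_integral do rewrite sumEFin (mpartition_indic _ pA).
by rewrite integral_cst // mul1e.
Qed.

(** * Product cells on blocks *)

Section box_partition.
Context {R : realType} d {T : measurableType d} (n m : nat) (A : 'I_m -> set T).
Hypothesis pA : finite_mpartition A.
Variables (mu : {measure set (n.-tuple T) -> \bar R}) (w : n.-tuple T -> \bar R).
Hypotheses (mw : measurable_fun setT w) (w0 : forall u, 0 <= w u).

Let mA i : measurable (A i). Proof. by case: pA. Qed.

Let mbox (i : {ffun 'I_n -> 'I_m}) : measurable (box (fun t => A (i t))).
Proof. exact: measurable_box. Qed.

Let mF (i : {ffun 'I_n -> 'I_m}) :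
  measurable_fun setT (fun u => (\1_(box (fun t => A (i t))) u)%:E * w u).
Proof. by apply: emeasurable_funM => //; apply/measurable_EFinP; exact: measurable_indic. Qed.

Let F0 (i : {ffun 'I_n -> 'I_m}) u : 0 <= (\1_(box (fun t => A (i t))) u)%:E * w u.
Proof. by rewrite mule_ge0 // lee_fin. Qed.

Let indic_boxE (i : {ffun 'I_n -> 'I_m}) u :
  \1_(box (fun t => A (i t))) u = (\prod_t \1_(A (i t)) (tnth u t))%R :> R.
Proof. by apply: EFin_inj; rewrite -prod_indic_box prodEFin. Qed.

(** For a fixed block [u] the cell indicators at each place form a degenerate law, so the sums over
    product laws apply pointwise under the integral. *)
Lemma box_partition_sum :
  \sum_(i : {ffun 'I_n -> 'I_m}) \int[mu]_u ((\1_(box (fun t => A (i t))) u)%:E * w u) =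
  \int[mu]_u w u.
Proof.
rewrite -ge0_integral_sum //; apply: eq_integral => u _.
rewrite -ge0_sume_distrl; last by move=> i _; rewrite lee_fin.
rewrite sumEFin; under eq_bigr do rewrite indic_boxE.
rewrite (@prod_kernel1 R _ _ (fun t a => \1_(A a) (tnth u t))) ?mul1e // => t.
exact: mpartition_indic.
Qed.

Lemma box_partition_marginal t x :
  \sum_(i : {ffun 'I_n -> 'I_m} | i t == x)
    \int[mu]_u ((\1_(box (fun t => A (i t))) u)%:E * w u) =
  \int[mu]_u ((\1_(A x) (tnth u t))%:E * w u).
Proof.
rewrite -big_filter -ge0_integral_sum //; apply: eq_integral => u _.
rewrite -ge0_sume_distrl; last by move=> i _; rewrite lee_fin.
rewrite sumEFin big_filter big_mkcond /=; congr (_%:E * _).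
rewrite (eq_bigr (fun i : {ffun 'I_n -> 'I_m} => (\prod_k \1_(A (i k)) (tnth u k)) * (i t == x)%:R)%R).
  have P1 k : (\sum_a \1_(A a) (tnth u k) = 1 :> R)%R by exact: mpartition_indic.
  apply: (etrans (prod_kernel_factor1 P1 (fun a => (a == x)%:R)%R t)).
  by rewrite (bigD1 x) //= eqxx mulr1 big1 ?addr0 // => a /negbTE ->; rewrite mulr0.
by move=> i _; case: ifP => _; rewrite ?mulr0 // mulr1 indic_boxE.
Qed.

End box_partition.

Section joint_law.
Context {R : realType} d {X : measurableType d} (PX : probability X R) (k : R.-pker X ~> X).

(** [joint_law] is a bare set function; this form yields its additivity over partitions from that of
    the integral. *)
Lemma joint_lawE A B : measurable A -> measurable B ->
  joint_law PX k (A `*` B) = \int[PX]_x ((\1_A x)%:E * k x B).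
Proof.
move=> mA mB; apply: eq_integral => x _; have [xA|xA] := pselect (A x).
  rewrite indicE mem_set // mul1e; congr (k x _).
  by apply/seteqP; split => y /=; [case|].
rewrite indicE memNset // mul0e (_ : [set y | _] = set0) ?measure0 //.
by apply/seteqP; split => y //= -[].
Qed.

Let mF A B : measurable A -> measurable B ->
  measurable_fun setT (fun x => (\1_A x)%:E * k x B).
Proof.
move=> mA mB; apply: emeasurable_funM; last exact: measurable_kernel.
by apply/measurable_EFinP; exact: measurable_indic.
Qed.

Let F0 A B x : 0 <= (\1_A x)%:E * k x B.
Proof. by rewrite mule_ge0 // lee_fin. Qed.

Lemma joint_law_margl A : measurable A -> joint_law PX k (A `*` setT) = PX A.
Proof.
move=> mA; rewrite joint_lawE //; under eq_integral do rewrite prob_kernel mule1.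
by rewrite integral_indic // setIT.
Qed.

Lemma joint_law_sumr A m (B : 'I_m -> set X) : measurable A -> finite_mpartition B ->
  \sum_j joint_law PX k (A `*` B j) = joint_law PX k (A `*` setT).
Proof.
move=> mA pB; have [mB _ _] := pB.
rewrite joint_lawE //; under eq_bigr do rewrite joint_lawE //.
rewrite -ge0_integral_sum //; last by move=> j; exact: mF.
apply: eq_integral => x _.
by rewrite -ge0_sume_distrr // mpartition_measure.
Qed.

Lemma joint_law_suml m (A : 'I_m -> set X) B : finite_mpartition A -> measurable B ->
  \sum_i joint_law PX k (A i `*` B) = joint_law PX k (setT `*` B).
Proof.
move=> pA mB; have [mA _ _] := pA.
rewrite joint_lawE //; under eq_bigr do rewrite joint_lawE //.
rewrite -ge0_integral_sum //; last by move=> j; exact: mF.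
apply: eq_integral => x _.
rewrite -ge0_sume_distrl; last by move=> i _; rewrite lee_fin.
by rewrite sumEFin (mpartition_indic x pA) indicT.
Qed.

Lemma joint_law_le1 A B : measurable A -> measurable B -> joint_law PX k (A `*` B) <= 1.
Proof.
move=> mA mB; rewrite joint_lawE //.
apply: (@le_trans _ _ (\int[PX]_x (\1_A x)%:E)).
  apply: ge0_le_integral => //; first exact: mF.
  - by apply/measurable_EFinP; exact: measurable_indic.
  - move=> x _; rewrite -[leRHS]mule1 lee_wpmul2l ?lee_fin //.
    by rewrite -(prob_kernel (s := k) x); apply: le_measure; rewrite ?inE.
by rewrite integral_indic // setIT probability_le1.
Qed.

Lemma joint_law_fin A B : measurable A -> measurable B ->
  joint_law PX k (A `*` B) \is a fin_num.
Proof.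
move=> mA mB; rewrite ge0_fin_numE ?(le_lt_trans (joint_law_le1 mA mB)) ?ltry //.
by apply: integral_ge0 => x _.
Qed.
End joint_law.

Lemma integral_one {R : realType} d (T : measurableType d) (P : probability T R) :
  \int[P]_x cst 1 x = 1 :> \bar R.
Proof. by rewrite integral_cst // mul1e; exact: probability_setT. Qed.

Section converse.
Context {R : realType} {d} {X : measurableType d} (PX : probability X R) (n : nat).
Variable Pn : probability (n.-tuple X) R.
Hypothesis iidPn : iid_law PX Pn.
Variables (enc : R.-pker (n.-tuple X) ~> nat) (dec : R.-pker nat ~> n.-tuple X).
Hypothesis n0 : (0 < n)%N.
Variable K : R.-pker X ~> X.
Hypothesis KE : forall x,
  (forall U, measurable U -> K x U = \sum_(t < n) (n%:R^-1)%:E *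
     \int[Pn]_u \int[enc (set_coord t (x, u))]_z dec z [set y | U (tnth y t)]) /\
  forall f : X -> \bar R, measurable_fun setT f -> (forall y, 0 <= f y) ->
    \int[K x]_y f y = \sum_(t < n) (n%:R^-1)%:E *
     \int[Pn]_u \int[enc (set_coord t (x, u))]_z \int[dec z]_y f (tnth y t).

Let menc z : measurable_fun setT (fun u => enc u [set z]).
Proof. exact: measurable_kernel. Qed.

Let enc1 u z : enc u [set z] <= 1.
Proof. by rewrite -(prob_kernel (s := enc) u); apply: le_measure; rewrite ?inE. Qed.

Lemma code_pmfE z : (code_pmf Pn enc z)%:E = \int[Pn]_u enc u [set z].
Proof.
rewrite fineK // ge0_fin_numE; last by apply: integral_ge0.
apply: (@le_lt_trans _ _ (\int[Pn]_u cst 1 u)); first exact: ge0_le_integral.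
by rewrite integral_one ltry.
Qed.

Lemma code_pmf_le1 z : (code_pmf Pn enc z <= 1)%R.
Proof.
rewrite -lee_fin code_pmfE.
apply: (@le_trans _ _ (\int[Pn]_u cst 1 u)); first exact: ge0_le_integral.
by rewrite integral_one.
Qed.

Lemma pair_law_series t A B : measurable A -> measurable B ->
  pair_law Pn enc dec t A B = \sum_(0 <= z <oo)
    (\int[Pn]_u ((\1_A (tnth u t))%:E * enc u [set z])) * dec z [set y | B (tnth y t)].
Proof.
move=> mA mB; rewrite /pair_law.
have mI : measurable_fun setT (fun u : n.-tuple X => (\1_A (tnth u t))%:E : \bar R).
  apply/measurable_EFinP; apply: measurableT_comp; first exact: measurable_indic.
  exact: measurable_tnth.
have mF z : measurable_fun setT (fun u => (\1_A (tnth u t))%:E * enc u [set z]).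
  exact: emeasurable_funM.
have F0 z u : 0 <= (\1_A (tnth u t))%:E * enc u [set z].
  by rewrite mule_ge0 // lee_fin.
transitivity (\int[Pn]_u \sum_(0 <= z <oo)
    ((\1_A (tnth u t))%:E * enc u [set z] * dec z [set y | B (tnth y t)])).
  apply: eq_integral => u _; rewrite integral_nat //.
  rewrite -nneseriesZl; last by move=> z _; rewrite mule_ge0.
  by apply: eq_eseriesr => z _; rewrite [dec _ _ * _]muleC muleA.
rewrite integral_nneseries //; last first.
  by move=> z; apply: emeasurable_funM => //; exact: measurable_cst.
by apply: eq_eseriesr => z _; rewrite ge0_integralZr.
Qed.

(** After quantisation [e z i] is the probability that the source block lies in cell [i] and [z] is
    sent, and [dd z j] that the output lies in cell [j] given [z]. Dropping the event on [z] bounds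
    [e z i] by the product law of the source. *)
Lemma converse_mutual_info (r : R) :
  (n%:R^-1)%:E * entropy (code_pmf Pn enc) <= r%:E ->
  mutual_info (joint_law PX K) <= r%:E.
Proof.
have n0R : (0 < n%:R :> R)%R by rewrite ltr0n.
rewrite lee_pdivrMl // => hH.
apply: ge_ereal_sup => _ [m [k [A [B [pA pB ->]]]]].
have [mA _ _] := pA; have [mB _ _] := pB.
have mAi (i : {ffun 'I_n -> 'I_m}) : measurable (box (fun t => A (i t))) by exact: measurable_box.
have mBj (j : {ffun 'I_n -> 'I_k}) : measurable (box (fun t => B (j t))) by exact: measurable_box.
pose E z (i : {ffun 'I_n -> 'I_m}) := \int[Pn]_u ((\1_(box (fun t => A (i t))) u)%:E * enc u [set z]).
have mE z i : measurable_fun setT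
    (fun u => (\1_(box (fun t => A ((i : {ffun 'I_n -> 'I_m}) t))) u)%:E * enc u [set z]).
  by apply: emeasurable_funM => //; apply/measurable_EFinP; exact: measurable_indic.
have E0 z i : 0 <= E z i.
  by apply: integral_ge0 => u _; rewrite mule_ge0 // lee_fin.
have Ebox z i : E z i <= \prod_t PX (A (i t)).
  rewrite -iidPn // -[X in _ <= Pn X](setIT (box (fun t => A (i t)))) -integral_indic //.
  apply: ge0_le_integral => //.
  - by apply/measurable_EFinP; exact: measurable_indic.
  - by move=> u _; rewrite -[leRHS]mule1 lee_wpmul2l ?lee_fin.
have Efin z i : E z i \is a fin_num.
  rewrite ge0_fin_numE // (le_lt_trans (Ebox z i)) // -ge0_fin_numE ?prode_ge0 //.
  by apply: prode_fin_num => t _; exact: fin_num_measure.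
pose D z (j : {ffun 'I_n -> 'I_k}) := dec z (box (fun t => B (j t))).
have Dint z j : D z j = \int[dec z]_y ((\1_(box (fun t => B (j t))) y)%:E * cst 1 y).
  by under eq_integral do rewrite mule1; rewrite integral_indic // setIT.
have Dfin z j : D z j \is a fin_num.
  rewrite ge0_fin_numE //; apply: (@le_lt_trans _ _ 1); last exact: ltry.
  by rewrite -(prob_kernel (s := dec) z); apply: le_measure; rewrite ?inE.
pose e z i := fine (E z i); pose dd z j := fine (D z j).
pose Pt t x y := fine (pair_law Pn enc dec t (A x) (B y)).
have jfin A' B' : measurable A' -> measurable B' ->
  joint_law PX K (A' `*` B') \is a fin_num by move=> *; exact: joint_law_fin.
have pl0 t x y : 0 <= pair_law Pn enc dec t (A x) (B y).
  apply: integral_ge0 => u _; rewrite mule_ge0 ?lee_fin //; exact: integral_ge0.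
(* Finiteness is inherited from [joint_law], of which [pair_law] is, up to the factor [1 / n], one
   of [n] nonnegative summands. *)
have plfin t x y : pair_law Pn enc dec t (A x) (B y) \is a fin_num.
  rewrite ge0_fin_numE //.
  have := jfin _ _ (mA x) (mB y).
  rewrite (averaged_joint_law iidPn KE) // => h.
  have h0 : forall s : 'I_n, 0 <= (n%:R^-1)%:E * pair_law Pn enc dec s (A x) (B y).
    by move=> s; rewrite mule_ge0 // lee_fin invr_ge0.
  move: h; rewrite ge0_fin_numE ?sume_ge0 // => h.
  have : (n%:R^-1)%:E * pair_law Pn enc dec t (A x) (B y) < +oo.
    by apply: le_lt_trans h; rewrite (bigD1 t) //= leeDl // sume_ge0.
  by rewrite lte_pdivrMl // mulry gtr0_sg // mul1e.
have PtE t x y : \sum_(0 <= z <oo)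
   ((\sum_(i : {ffun 'I_n -> 'I_m} | i t == x) e z i) *
    (\sum_(j : {ffun 'I_n -> 'I_k} | j t == y) dd z j))%:E = (Pt t x y)%:E.
  rewrite fineK // pair_law_series //; apply: eq_eseriesr => z _.
  rewrite EFinM; congr (_ * _).
    rewrite -sumEFin; under eq_bigr do rewrite fineK //.
    by rewrite box_partition_marginal.
  rewrite -sumEFin; under eq_bigr do rewrite fineK // Dint.
  rewrite box_partition_marginal //.
  under eq_integral do rewrite mule1.
  rewrite (eq_integral (fun u : n.-tuple X => (\1_[set y0 | B y (tnth y0 t)] u)%:E)) //.
  by rewrite integral_indic ?setIT //; exact: measurable_preimage_tnth.
have pbE x y : (n%:R^-1 * \sum_t Pt t x y)%R = fine (joint_law PX K (A x `*` B y)).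
  rewrite (averaged_joint_law iidPn KE) // mulr_sumr.
  apply: EFin_inj; rewrite fineK.
    by rewrite -sumEFin; apply: eq_bigr => t _; rewrite EFinM fineK.
  by rewrite -(averaged_joint_law iidPn KE) // jfin.
have := @code_information R n m k e dd Pt
  (fun x => fine (joint_law PX K (A x `*` setT)))
  (fun y => fine (joint_law PX K (setT `*` B y)))
  (code_pmf Pn enc) (n%:R * r)%R n0.
move=> H; rewrite lee_fin -(ler_pM2l n0R).
apply: le_trans (H _ _ _ _ _ _ _ _ _ _).
- rewrite ler_pM2l //; apply: ler_sum => x _; apply: ler_sum => y _.
  rewrite pbE /mi_term; case: eqP => [->|//]; by rewrite mul0r.
- by move=> z i; exact: fine_ge0.
- by move=> z j; exact: fine_ge0.
- move=> z; apply: EFin_inj; rewrite -sumEFin.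
  under eq_bigr do rewrite fineK // Dint.
  rewrite box_partition_sum // integral_cst // mul1e; exact: prob_kernel.
- move=> z; apply: EFin_inj; rewrite code_pmfE -sumEFin.
  under eq_bigr do rewrite fineK //.
  by rewrite box_partition_sum.
- exact: code_pmf_le1.
- move=> z i; rewrite -lee_fin fineK // (le_trans (Ebox z i)) //.
  rewrite -prodEFin le_eqVlt; apply/orP; left; apply/eqP; apply: eq_bigr => t _.
  by rewrite fineK ?jfin // joint_law_margl.
- exact: PtE.
- move=> x; under eq_bigr do rewrite pbE.
  apply: EFin_inj; rewrite -sumEFin; under eq_bigr do rewrite fineK ?jfin //.
  by rewrite joint_law_sumr // fineK // jfin.
- move=> y; under eq_bigr do rewrite pbE.
  apply: EFin_inj; rewrite -sumEFin; under eq_bigr do rewrite fineK ?jfin //.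
  by rewrite joint_law_suml // fineK // jfin.
- exact: hH.
Qed.
End converse.

(** Level zero forces every output letter to have law [PX]; their average then has it too, so the
    averaged kernel competes in [RDP]. *)
Lemma converse {R : realType} {d} (X : measurableType d) (PX : probability X R)
  (Delta : X -> X -> R) (dv : probability X R -> probability X R -> \bar R) (D r : R) :
  is_distortion Delta -> is_divergence dv -> achievable_pr PX Delta dv D 0 r ->
  RDP PX Delta dv D 0 <= r%:E.
Proof.
move=> [mD D0 _] [dv0 dvl dvE] [N].
(* Achievability quantifies over the i.i.d. block laws, so one has to be exhibited; the length
   [N.+1] is both admissible and positive. *)
have [Pn iidPn] := tuple_product_box (fun _ : 'I_N.+1 => PX).
move=> /(_ N.+1 (leqnSn N) Pn iidPn)[enc [dec [hH hD hP]]].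
have n0 : (0 < N.+1)%N by [].
have [K KE] := averaged_kernel_exists Pn enc dec n0.
have hmi := converse_mutual_info iidPn n0 KE hH.
apply: le_trans hmi; apply: ereal_inf_lbound; exists K => //.
split; first by rewrite (averaged_distortion iidPn KE).
exists PX; split; last by rewrite ((dvE PX PX).2 _).
have outE t B : measurable B -> code_out_law Pn enc dec t B = PX B.
  move=> mB; have [nu [nuE dvnu]] := hP t.
  have /dvE nuP : dv PX nu = 0 by apply/eqP; rewrite eq_le dvnu dv0.
  by rewrite -nuE // nuP.
move=> B mB.
have -> : out_law PX K B = joint_law PX K (setT `*` B).
  rewrite joint_lawE //; apply: eq_integral => x _.
  by rewrite indicT mul1e.
rewrite (averaged_joint_law iidPn KE) //.
have pl t : pair_law Pn enc dec t setT B = PX B.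
  rewrite -(outE t B mB); apply: eq_integral => u _.
  by rewrite indicT mul1e.
under eq_bigr do rewrite pl.
rewrite -ge0_sume_distrl; last by move=> i _; rewrite lee_fin invr_ge0.
by rewrite sumEFin sumr_const card_ord -[(_ *+ _)%R]mulr_natr mulVf ?mul1e.
Qed.

(** * One-shot coding *)

(** The inverse is the real power [-1], both being 0 at 0. *)
Lemma measurable_inv_ge0 {R : realType} d (T : measurableType d) (h : T -> R) :
  measurable_fun setT h -> (forall x, (0 <= h x)%R) ->
  measurable_fun setT (fun x => (h x)^-1)%R.
Proof.
move=> mh h0.
rewrite (_ : (fun x => _) = (fun y : R => y `^ (-1))%R \o h); last first.
  by apply/funext => x /=; rewrite powR_inv1.
exact: measurableT_comp (measurable_powR _) mh.
Qed.

Section two_level_entropy.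
Local Open Scope ring_scope.

(** Gibbs against the reference that spreads one half of the mass over the support of [p1] and one
    half over [Z2]; [ln 2] pays for naming the mode. [N] counts the support and not [Z1], because
    codebooks of weight zero must cost nothing. *)
Lemma two_level_entropy (R : realType) (Z1 Z2 : finType) (p1 : Z1 -> R) (p2 : Z2 -> R)
  (N : nat) :
  (forall z, 0 <= p1 z) -> (forall z, 0 <= p2 z) ->
  \sum_z p1 z + \sum_z p2 z = 1 ->
  (0 < N)%N -> (#|[set z | p1 z != 0%R]%SET| <= N)%N -> (0 < #|Z2|)%N ->
  \sum_z - (p1 z * ln (p1 z)) + \sum_z - (p2 z * ln (p2 z)) <=
  ln 2 + ln N%:R + (\sum_z p2 z) * ln #|Z2|%:R.
Proof.
move=> p10 p20 p12 N0 SN Z20.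
have NR : 0 < N%:R :> R by rewrite ltr0n.
have ZR : 0 < #|Z2|%:R :> R by rewrite ltr0n.
have q1p : 0 < (2 * N%:R)^-1 :> R by rewrite invr_gt0 mulr_gt0.
have q2p : 0 < (2 * #|Z2|%:R)^-1 :> R by rewrite invr_gt0 mulr_gt0.
have b1 : \sum_z - (p1 z * ln (p1 z)) <=
    (\sum_z p1 z) * (ln 2 + ln N%:R) + 2^-1 - \sum_z p1 z.
  apply: (@le_trans _ _ (\sum_z (p1 z * (ln 2 + ln N%:R)
     + ((p1 z != 0)%:R * (2 * N%:R)^-1 - p1 z)))).
    apply: ler_sum => z _; have [->|pz] := eqVneq (p1 z) 0.
      by rewrite !mul0r oppr0 !addr0.
    have := gibbs_term (p10 z) q1p.
    by rewrite lnV ?posrE ?mulr_gt0 // lnM ?posrE // mul1r mulrN opprK.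
  rewrite big_split sumrB -!mulr_suml -addrA lerD2l lerD2r.
  rewrite -natr_sum.
  have -> : (\sum_z (p1 z != 0%R) = #|[set z | p1 z != 0%R]%SET|)%N.
    by rewrite -sum1_card [RHS]big_mkcond /=; apply: eq_bigr => z _; rewrite inE; case: (_ != _).
  by rewrite ler_pdivrMr ?mulr_gt0 // mulrA mulVf // mul1r ler_nat.
have b2 : \sum_z - (p2 z * ln (p2 z)) <=
    (\sum_z p2 z) * (ln 2 + ln #|Z2|%:R) + 2^-1 - \sum_z p2 z.
  apply: (@le_trans _ _ (\sum_z (p2 z * (ln 2 + ln #|Z2|%:R)
     + ((2 * #|Z2|%:R)^-1 - p2 z)))).
    apply: ler_sum => z _; have := gibbs_term (p20 z) q2p.
    by rewrite lnV ?posrE ?mulr_gt0 // lnM ?posrE // mulrN opprK.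
  rewrite big_split sumrB -!mulr_suml -addrA lerD2l lerD2r.
  by rewrite sumr_const -[(_ *+ _)]mulr_natr invfM -mulrA mulVf ?mulr1 // gt_eqF.
have lnN : 0 <= ln N%:R :> R by rewrite ln_ge0 // ler1n.
have s20 : 0 <= \sum_z p2 z by rewrite sumr_ge0.
have s1E : \sum_z p1 z = 1 - \sum_z p2 z by rewrite -p12 addrK.
have : 0 <= (\sum_z p2 z) * ln N%:R by rewrite mulr_ge0.
move: b1 b2; rewrite s1E; lra.
Qed.
End two_level_entropy.

Section one_shot.
Context {R : realType} {d} {O : measurableType d} (P : probability O R).
Context {T I : finType} (K : nat) (pi : T -> R) (W : T -> O -> R).
Variables (typ : T -> O -> bool) (M gam : R) (g : I -> T -> O -> \bar R).
Hypotheses (K0 : (0 < K)%N) (pi0 : forall s, (0 < pi s)%R) (pi1 : (\sum_s pi s = 1)%R).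
Hypotheses (mW : forall s, measurable_fun setT (W s)) (W0 : forall s x, (0 <= W s x)%R).
Hypothesis W1 : forall x, (\sum_s W s x = 1)%R.
Hypothesis mtyp : forall s, measurable_fun setT (typ s).
Hypothesis typM : forall s x, typ s x -> (W s x <= M * pi s)%R.
Hypotheses (gam0 : (0 < gam)%R) (M0 : (0 <= M)%R) (MK : (M <= gam ^+ 2 * K%:R)%R).
Hypotheses (mg : forall i s, measurable_fun setT (g i s)) (g0 : forall i s x, 0 <= g i s x).
Hypothesis gfin : forall i, \int[P]_x \sum_s (W s x)%:E * g i s x < +oo.

Let lam := @book_prob R T K pi.
(** Likelihood of [s] relative to the codebook law, cut to 0 off the typical pairs so that it is
    bounded by [M]. *)
Let f (x : O) (s : T) : R := if typ s x then (W s x / pi s)%R else 0%R.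
Let sel (x : O) c (k : 'I_K) : R := book_sel (f x) c k.
Let miss (c : {ffun 'I_K -> T}) (x : O) : R := (1 - \sum_k sel x c k)%R.
Let hit (x : O) (s : T) : R := (\sum_c lam c * \sum_(k | c k == s) sel x c k)%R.
Let res (x : O) : R := (1 - \sum_s hit x s)%R.
(** Normalised deficit of the likelihood encoder. Where the deficit vanishes [W] is the default, so
    that [rho] is a law in [s] at every [x]. *)
Let rho (s : T) (x : O) : R := if res x == 0%R then W s x else ((W s x - hit x s) / res x)%R.
(* Channel of the code with codebook [c]: the likelihood encoder [sel] when it
   succeeds, and otherwise the fallback law [rho], which is chosen so that the
   average of these channels over [c] is exactly [W]. *)
Let Tc (c : {ffun 'I_K -> T}) (s : T) (x : O) : R :=
  (\sum_(k | c k == s) sel x c k + miss c x * rho s x)%R.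

Let pi0W s : (0 <= pi s)%R. Proof. exact: ltW. Qed.

Let f0 x s : (0 <= f x s)%R.
Proof. by rewrite /f; case: ifP => // _; rewrite divr_ge0. Qed.

Let fM x s : (f x s <= M)%R.
Proof. by rewrite /f; case: ifP => // /typM; rewrite ler_pdivrMr. Qed.

Let pif x s : (pi s * f x s = if typ s x then W s x else 0)%R.
Proof. by rewrite /f; case: ifP => _; rewrite ?mulr0 // mulrC divfK // gt_eqF. Qed.

Let pif_le1 x : (\sum_s pi s * f x s <= 1)%R.
Proof. by rewrite -(W1 x) ler_sum // => s _; rewrite pif; case: ifP. Qed.

Let sel0 x c k : (0 <= sel x c k)%R. Proof. exact: book_sel_ge0. Qed.

Let miss0 c x : (0 <= miss c x)%R.
Proof. by rewrite subr_ge0; exact: book_sel_sum_le1. Qed.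

Let miss1 c x : (miss c x <= 1)%R.
Proof. by rewrite gerBl sumr_ge0. Qed.

Let lam0 c : (0 < lam c)%R. Proof. exact: prodr_gt0. Qed.

Let lam1 : (\sum_c lam c = 1)%R. Proof. exact: prod_pmf1. Qed.

Let hit_le x s : (hit x s <= W s x)%R.
Proof.
apply: (le_trans (book_sel_le K0 pi0W pi1 (f0 x) s)).
by rewrite pif; case: ifP.
Qed.

Let sum_fiber (x : O) (c : {ffun 'I_K -> T}) :
  (\sum_s \sum_(k | c k == s) sel x c k = \sum_k sel x c k)%R.
Proof. by rewrite [RHS](partition_big c predT). Qed.

Let resE x : (res x = \sum_c lam c * miss c x)%R.
Proof.
rewrite /res /hit exchange_big /=.
under eq_bigr do rewrite -mulr_sumr sum_fiber.
rewrite /miss; under [RHS]eq_bigr do rewrite mulrBr mulr1.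
by rewrite sumrB lam1.
Qed.

Let resE2 x : (res x = \sum_s (W s x - hit x s))%R.
Proof. by rewrite sumrB W1. Qed.

Let res0 x : (0 <= res x)%R.
Proof. by rewrite resE2 sumr_ge0 // => s _; rewrite subr_ge0. Qed.

Let rho0 s x : (0 <= rho s x)%R.
Proof. by rewrite /rho; case: ifP => // _; rewrite divr_ge0 // subr_ge0. Qed.

Let rho1 x : (\sum_s rho s x = 1)%R.
Proof.
rewrite /rho; case: eqP => [_|/eqP rn]; first exact: W1.
by rewrite -mulr_suml -resE2 divff.
Qed.

Let Tc0 c s x : (0 <= Tc c s x)%R.
Proof. by rewrite addr_ge0 ?mulr_ge0 // sumr_ge0. Qed.

(** If [res x] vanishes, so does each nonnegative term [W - hit] of it; otherwise the average of
    [miss] is [res], which cancels the normalisation of [rho]. *)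
Let TcW s x : (\sum_c lam c * Tc c s x = W s x)%R.
Proof.
rewrite /Tc; under eq_bigr do rewrite mulrDr mulrA.
rewrite big_split /= -mulr_suml -resE -/(hit x s) /rho.
case: eqP => [r0|/eqP rn]; last by rewrite mulrC divfK // addrCA subrr addr0.
rewrite r0 mul0r addr0; apply/eqP; rewrite eq_sym -subr_eq0.
have := r0; rewrite resE2 => /eqP; rewrite psumr_eq0; last by move=> t _; rewrite subr_ge0.
by move=> /allP/(_ s); rewrite mem_index_enum; apply.
Qed.

Let mf s : measurable_fun setT (f^~ s).
Proof.
apply: measurable_fun_ifT => //.
by apply: measurable_funM => //; exact: measurable_cst.
Qed.

Let msel c k : measurable_fun setT (fun x => sel x c k).
Proof.
apply: measurable_funM => //; apply: measurable_inv_ge0.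
  apply: measurable_funM; first exact: measurable_cst.
  apply: measurable_maxr; first exact: measurable_cst.
  by apply: measurable_funM; [exact: measurable_sum|exact: measurable_cst].
by move=> x; rewrite mulr_ge0 // le_max ler01.
Qed.

Let mfiber (c : {ffun 'I_K -> T}) s : measurable_fun setT (fun x => (\sum_(k | c k == s) sel x c k)%R).
Proof. by under eq_fun do rewrite -big_filter; exact: measurable_sum. Qed.

Let mmiss c : measurable_fun setT (miss c).
Proof. by apply: measurable_funB; [exact: measurable_cst|exact: measurable_sum]. Qed.

Let mhit s : measurable_fun setT (hit^~ s).
Proof.
apply: measurable_sum => c; apply: measurable_funM => //; exact: measurable_cst.
Qed.

Let mres : measurable_fun setT res.
Proof. by apply: measurable_funB; [exact: measurable_cst|exact: measurable_sum]. Qed.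

Let mrho s : measurable_fun setT (rho s).
Proof.
apply: measurable_fun_ifT => //; first by apply: measurable_fun_eqr => //; exact: measurable_cst.
by apply: measurable_funM; [exact: measurable_funB|exact: measurable_inv_ge0].
Qed.

Let mTc c s : measurable_fun setT (Tc c s).
Proof. by apply: measurable_funD => //; exact: measurable_funM. Qed.

Let intTg c i := \int[P]_x \sum_s (Tc c s x)%:E * g i s x.

Let mTg c i : measurable_fun setT (fun x => \sum_s (Tc c s x)%:E * g i s x).
Proof.
apply: emeasurable_sum => s; apply: emeasurable_funM => //.
exact/measurable_EFinP.
Qed.

Let Tg0 c i x : 0 <= \sum_s (Tc c s x)%:E * g i s x.
Proof. by apply: sume_ge0 => s _; rewrite mule_ge0 // lee_fin. Qed.

Let mix_intTg (mu : {ffun 'I_K -> T} -> R) i : (forall c, (0 <= mu c)%R) ->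
  \int[P]_x \sum_s ((\sum_c mu c * Tc c s x)%R)%:E * g i s x = \sum_c (mu c)%:E * intTg c i.
Proof.
move=> mu0.
transitivity (\int[P]_x \sum_c (mu c)%:E * \sum_s (Tc c s x)%:E * g i s x).
  apply: eq_integral => x _.
  under eq_bigr => s _.
    rewrite -sumEFin ge0_sume_distrl; last by move=> c _; rewrite lee_fin mulr_ge0.
    over.
  rewrite exchange_big; apply: eq_bigr => c _.
  rewrite ge0_sume_distrr; last by move=> s _; rewrite mule_ge0 // lee_fin.
  by apply: eq_bigr => s _; rewrite EFinM muleA.
rewrite ge0_integral_sum //; last 2 first.
  - by move=> c; exact: measurable_funeM.
  - by move=> c x _; rewrite mule_ge0 // lee_fin.
by apply: eq_bigr => c _; rewrite ge0_integralZl // lee_fin.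
Qed.

Let intTg_sum i : \sum_c (lam c)%:E * intTg c i = \int[P]_x \sum_s (W s x)%:E * g i s x.
Proof.
rewrite -mix_intTg; last by move=> c; exact: ltW.
by apply: eq_integral => x _; apply: eq_bigr => s _; rewrite TcW.
Qed.

Let intTg0 c i : 0 <= intTg c i. Proof. exact: integral_ge0. Qed.

(** Every codebook has positive weight, so a finite average forces each term to be finite: the
    functionals become real, as [caratheodory] asks. *)
Let intTg_fin c i : intTg c i \is a fin_num.
Proof.
rewrite ge0_fin_numE //.
have : (lam c)%:E * intTg c i < +oo.
  apply: le_lt_trans (gfin i); rewrite -intTg_sum (bigD1 c) //= leeDl //.
  by apply: sume_ge0 => c' _; rewrite mule_ge0 // lee_fin ltW.
move=> h; rewrite ltey; apply/eqP => e; move: h; rewrite e.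
by rewrite gt0_muley ?lte_fin // ltxx.
Qed.

Let intmiss c := \int[P]_x (miss c x)%:E.

Let intmiss0 c : 0 <= intmiss c.
Proof. by apply: integral_ge0 => x _; rewrite lee_fin. Qed.

Let intmiss_fin c : intmiss c \is a fin_num.
Proof.
rewrite ge0_fin_numE //; apply: (@le_lt_trans _ _ (\int[P]_x cst 1 x)).
  apply: ge0_le_integral => //.
  - by move=> x _; rewrite lee_fin.
  - exact/measurable_EFinP.
  - by move=> x _; rewrite lee_fin.
by rewrite integral_one ltry.
Qed.

(** A message is either a codebook with one of its entries or a plain word. The functionals in [V]
    are the total mass, the failure probability and the [#|I|] constraints, whence [#|I|.+2]
    codebooks. *)
Lemma one_shot_coding (eta : R) :
  \int[P]_x (\sum_(s | ~~ typ s x) W s x)%:E <= eta%:E ->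
  exists (Z : finType) (theta : Z -> O -> R) (sigma : Z -> T),
  [/\ (forall z, measurable_fun setT (theta z)), (forall z x, (0 <= theta z x)%R),
      (forall x, (\sum_z theta z x = 1)%R),
      (forall i, \int[P]_x \sum_z (theta z x)%:E * g i (sigma z) x =
                 \int[P]_x \sum_s (W s x)%:E * g i s x) &
      (\sum_z - (fine (\int[P]_x (theta z x)%:E) * ln (fine (\int[P]_x (theta z x)%:E)))
       <= ln 2 + ln (#|I|.+2 * K)%:R + (eta + gam) * ln #|T|%:R)%R].
Proof.
move=> heta; pose Z := (({ffun 'I_K -> T} * 'I_K) + T)%type.
pose V (c : {ffun 'I_K -> T}) (o : option (option I)) : R :=
  match o with
  | None => 1%R
  | Some None => fine (intmiss c)
  | Some (Some i) => fine (intTg c i)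
  end.
have [mu [mu0 muN muV]] := caratheodory V (fun c => ltW (lam0 c)).
have mu1 : (\sum_c mu c = 1)%R.
  have := muV None; rewrite /= -!mulr_suml !mulr1 lam1 => ->. by [].
(* In the uncoded mode the codebook is not transmitted: [rho] does not depend on it, so the failure
   weights are pooled. *)
pose theta (z : Z) (x : O) : R := match z with
  | inl ck => (mu ck.1 * sel x ck.1 ck.2)%R
  | inr s => ((\sum_c mu c * miss c x) * rho s x)%R end.
pose sigma (z : Z) : T := match z with inl ck => ck.1 ck.2 | inr s => s end.
have mtheta z : measurable_fun setT (theta z).
  case: z => [[c k]|s]; rewrite /theta /=.
    by apply: measurable_funM => //; exact: measurable_cst.
  apply: measurable_funM => //; apply: measurable_sum => c.
  by apply: measurable_funM => //; exact: measurable_cst.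
have theta0 z x : (0 <= theta z x)%R.
  case: z => [[c k]|s] /=; first by rewrite mulr_ge0.
  by rewrite mulr_ge0 // sumr_ge0 // => c _; rewrite mulr_ge0.
have theta1 x : (\sum_z theta z x = 1)%R.
  rewrite big_sumType /= -mulr_sumr rho1 mulr1.
  rewrite -(pair_bigA _ (fun c k => mu c * sel x c k)%R) /= -big_split /= -[RHS]mu1.
  by apply: eq_bigr => c _; rewrite -mulr_sumr -mulrDr /miss addrC subrK mulr1.
(* The word read off from the message follows the mixture of the channels [Tc] with weights [mu]. *)
have thetaE (h : T -> \bar R) x : (forall s, 0 <= h s) ->
    \sum_z (theta z x)%:E * h (sigma z) = \sum_s ((\sum_c mu c * Tc c s x)%R)%:E * h s.
  move=> h0; rewrite big_sumType /=.
  under [RHS]eq_bigr => s _.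
    rewrite (_ : (\sum_c _)%R = (\sum_c mu c * \sum_(k | c k == s) sel x c k)
        + (\sum_c mu c * miss c x) * rho s x)%R; last first.
      rewrite mulr_suml -big_split /=; apply: eq_bigr => c _.
      by rewrite /Tc mulrDr mulrA.
    rewrite EFinD ge0_muleDl; last 2 first.
    - by rewrite lee_fin sumr_ge0 // => c _; rewrite mulr_ge0 // sumr_ge0.
    - by rewrite lee_fin mulr_ge0 // sumr_ge0 // => c _; rewrite mulr_ge0.
    over.
  rewrite big_split /=; congr (_ + _).
  rewrite -(pair_bigA _ (fun c k => (mu c * sel x c k)%:E * h (c k))) /=.
  under [RHS]eq_bigr => s _.
    rewrite -sumEFin ge0_sume_distrl; last first.
      by move=> c _; rewrite lee_fin mulr_ge0 // sumr_ge0.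
    over.
  rewrite [RHS]exchange_big; apply: eq_bigr => c _ /=.
  rewrite (partition_big c predT) //=; apply: eq_bigr => s _.
  rewrite mulr_sumr -sumEFin ge0_sume_distrl; last first.
    by move=> k _; rewrite lee_fin mulr_ge0.
  by apply: eq_bigr => k /eqP ->.
exists Z, theta, sigma; split => //.
  move=> i.
  transitivity (\int[P]_x \sum_s ((\sum_c mu c * Tc c s x)%R)%:E * g i s x).
    by apply: eq_integral => x _; exact: (thetaE (fun s => g i s x)).
  rewrite mix_intTg // -intTg_sum.
  transitivity ((\sum_c mu c * fine (intTg c i))%R%:E).
    by rewrite -sumEFin; apply: eq_bigr => c _; rewrite EFinM fineK.
  rewrite (muV (Some (Some i))) -sumEFin.
  by apply: eq_bigr => c _; rewrite EFinM fineK.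
pose p z := fine (\int[P]_x (theta z x)%:E).
have pE z : (p z)%:E = \int[P]_x (theta z x)%:E.
  rewrite fineK // ge0_fin_numE; last by apply: integral_ge0 => x _; rewrite lee_fin.
  apply: (@le_lt_trans _ _ (\int[P]_x cst 1 x)); last by rewrite integral_one ltry.
  apply: ge0_le_integral => //.
  - by move=> x _; rewrite lee_fin.
  - exact/measurable_EFinP.
  - by move=> x _; rewrite lee_fin -(theta1 x) (bigD1 z) //= lerDl sumr_ge0.
have p0 z : (0 <= p z)%R by apply: fine_ge0; apply: integral_ge0 => x _; rewrite lee_fin.
have p1 : (\sum_z p z = 1)%R.
  apply: EFin_inj; rewrite -sumEFin; under eq_bigr do rewrite pE.
  rewrite -ge0_integral_sum //; last 2 first.
  - by move=> z; exact/measurable_EFinP.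
  - by move=> z x _; rewrite lee_fin.
  by under eq_integral do rewrite sumEFin theta1; exact: integral_one.
(* The failure probability is a preserved functional, so it equals its mean over all random
   codebooks, the integral of [res]. *)
have p2 : (\sum_s p (inr s) <= eta + gam)%R.
  have -> : (\sum_s p (inr s) = \sum_c mu c * fine (intmiss c))%R.
    apply: EFin_inj; rewrite -sumEFin; under eq_bigr do rewrite pE.
    rewrite -ge0_integral_sum //; last 2 first.
    - by move=> z; exact/measurable_EFinP.
    - by move=> z x _; rewrite lee_fin.
    under eq_integral do rewrite sumEFin /= -mulr_sumr rho1 mulr1 -sumEFin.
    rewrite ge0_integral_sum //; last 2 first.
    - move=> c; apply/measurable_EFinP; apply: measurable_funM => //; exact: measurable_cst.
    - by move=> c x _; rewrite lee_fin mulr_ge0.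
    rewrite -sumEFin; apply: eq_bigr => c _; rewrite EFinM fineK //.
    under eq_integral do rewrite EFinM.
    by rewrite ge0_integralZl //; [exact/measurable_EFinP|move=> x _; rewrite lee_fin|rewrite lee_fin].
  rewrite (muV (Some None)) /= -lee_fin.
  have -> : ((\sum_c lam c * fine (intmiss c))%R)%:E = \int[P]_x (res x)%:E.
    under [RHS]eq_integral do rewrite resE -sumEFin.
    rewrite ge0_integral_sum //; last 2 first.
    - move=> c; apply/measurable_EFinP; apply: measurable_funM => //; exact: measurable_cst.
    - by move=> c x _; rewrite lee_fin mulr_ge0 // ltW.
    rewrite -sumEFin; apply: eq_bigr => c _; rewrite EFinM fineK //.
    under [RHS]eq_integral do rewrite EFinM.
    rewrite ge0_integralZl //; [exact/measurable_EFinP|by move=> x _; rewrite lee_fin|].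
    by rewrite lee_fin ltW.
  have mnt : measurable_fun setT (fun x => (\sum_(s | ~~ typ s x) W s x)%R).
    under eq_fun do rewrite big_mkcond /=.
    apply: measurable_sum => s; apply: measurable_fun_ifT => //.
    exact: measurableT_comp (mtyp s).
  have nt0 x : (0 <= \sum_(s | ~~ typ s x) W s x)%R by rewrite sumr_ge0.
  apply: (@le_trans _ _ (\int[P]_x ((\sum_(s | ~~ typ s x) W s x)%:E + gam%:E))).
    apply: ge0_le_integral => //.
    - by move=> x _; rewrite lee_fin.
    - exact/measurable_EFinP.
    - by apply: emeasurable_funD; [exact/measurable_EFinP|exact: measurable_cst].
    move=> x _; rewrite -EFinD lee_fin.
    have := book_miss K0 pi0W pi1 (f0 x) gam0 (fM x) (pif_le1 x) MK.
    have -> : (1 - \sum_(c : {ffun 'I_K -> T}) book_prob pi c * \sum_k book_sel (f x) c k = res x)%R.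
      rewrite resE -[X in (X - _)%R]lam1 -sumrB; apply: eq_bigr => c _.
      by rewrite /miss mulrBr mulr1.
    have -> : (\sum_(s | ~~ typ s x) W s x = 1 - \sum_s pi s * f x s)%R.
      rewrite -(W1 x) (bigID (fun s => typ s x) predT) /= addrC.
      under [in X in (_ - X)%R]eq_bigr do rewrite pif.
      by rewrite -big_mkcond /= addrK.
    by [].
  rewrite ge0_integralD //; last 3 first.
  - by move=> x _; rewrite lee_fin.
  - exact/measurable_EFinP.
  - by move=> x _; rewrite lee_fin ltW.
  have -> : \int[P]_x gam%:E = gam%:E.
    by rewrite integral_cst // -[RHS]mule1; congr (_ * _); exact: probability_setT.
  by rewrite EFinD leeD2r.
have T0 : (0 < #|T|)%N.
  rewrite lt0n; apply/eqP => /card0_eq T0.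
  by move: pi1; rewrite big_pred0 // => /esym/eqP; rewrite oner_eq0.
have supp : (#|[set ck | p (inl ck) != 0%R]%SET| <= #|I|.+2 * K)%N.
  apply: (@leq_trans #|finset.setX [set c | mu c != 0%R]%SET [set: 'I_K]%SET|).
    apply: subset_leq_card; apply/fintype.subsetP => -[c k]; rewrite !inE andbT /=.
    apply: contra_neq => mc; rewrite /p integral0_eq // => x _.
    by rewrite /theta /= mc mul0r.
  rewrite cardsX cardsT card_ord leq_mul2r; apply/orP; right.
  by apply: leq_trans muN _; rewrite !card_option.
have N0 : (0 < #|I|.+2 * K)%N by rewrite muln_gt0.
have p12 : (\sum_ck p (inl ck) + \sum_s p (inr s) = 1)%R by rewrite -[RHS]p1 big_sumType.
have := two_level_entropy (fun z => p0 (inl z)) (fun z => p0 (inr z)) p12 N0 supp T0.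
rewrite big_sumType /= => h; apply: (le_trans h).
rewrite lerD2l; apply: ler_wpM2r => //.
by rewrite ln_ge0 // ler1n.
Qed.
End one_shot.

(** * Block codes *)

Section finite_chebyshev.
Local Open Scope ring_scope.

(** Beyond the threshold the centred sum is at least [#|I| * delta], because [b] bounds the mean
    from above; its square is then compared with its mean. *)
Lemma finite_chebyshev (R : realType) (I T : finType) (p h : T -> R) (b delta : R) :
  (forall t, 0 <= p t) -> \sum_t p t = 1 -> \sum_t p t * h t <= b -> 0 < delta ->
  (0 < #|I|)%N ->
  \sum_(c : {ffun I -> T} | #|I|%:R * (b + delta) < \sum_i h (c i)) \prod_i p (c i) <=
  (\sum_t p t * (h t - \sum_t p t * h t) ^+ 2) / (#|I|%:R * delta ^+ 2).
Proof.
move=> p0 p1 hb delta0 I0; set mh := \sum_t p t * h t.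
have IR : 0 < #|I|%:R :> R by rewrite ltr0n.
pose h' t := h t - mh.
have h'0 : \sum_t p t * h' t = 0.
  rewrite /h'; under eq_bigr do rewrite mulrBr.
  by rewrite sumrB -mulr_suml p1 mul1r subrr.
have dI : 0 < #|I|%:R * delta by rewrite mulr_gt0.
apply: (@le_trans _ _ (\sum_(c : {ffun I -> T})
    (\prod_i p (c i)) * (\sum_i h' (c i)) ^+ 2 / (#|I|%:R * delta) ^+ 2)).
  rewrite big_mkcond /=; apply: ler_sum => c _; case: ifP => [lt|_]; last first.
    by rewrite divr_ge0 ?sqr_ge0 // mulr_ge0 ?sqr_ge0 // prodr_ge0.
  rewrite -mulrA ler_peMr ?prodr_ge0 // ler_pdivlMr ?exprn_gt0 // mul1r.
  have key : #|I|%:R * delta <= \sum_i h' (c i).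
    rewrite /h' sumrB sumr_const -[mh *+ _]mulr_natl.
    have : #|I|%:R * mh <= #|I|%:R * b by rewrite ler_pM2l.
    move: lt; rewrite mulrDr; lra.
  by rewrite ler_pXn2r // nnegrE ?(le_trans (ltW dI) key) // ltW.
rewrite -mulr_suml prod_pmf_sqr //.
set v := \sum_t _; rewrite le_eqVlt; apply/orP; left; apply/eqP.
by field; rewrite !gt_eqF.
Qed.
End finite_chebyshev.

(** * Rounding the channel to a grid *)

Section cells.
Context {R : realType} {d} {X : measurableType d} (PX : probability X R).
Context {S : finType} (pi : S -> R) (W : S -> X -> R) (I0 : R) (L : nat).
Hypotheses (L0 : (0 < L)%N) (pi0 : forall s, (0 < pi s)%R).
Hypotheses (mW : forall s, measurable_fun setT (W s)) (W0 : forall s x, (0 <= W s x)%R).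
Hypothesis W1 : forall x, (\sum_s W s x = 1)%R.
Hypothesis WI : forall m (A : 'I_m -> set X), finite_mpartition A ->
  (\sum_i \sum_s mi_term (fine (\int[PX]_x (\1_(A i) x * W s x)%:E)) (fine (PX (A i))) (pi s)
   <= I0)%R.

Let C := {ffun S -> 'I_L.+1}.

(** Values of [W] at [x] rounded down to multiples of [1 / L]; the value 1 has index [L], hence
    ['I_L.+1]. *)
Definition cell (x : X) : C := [ffun s => inord (Num.truncn (L%:R * W s x))%R].

(** Rounded up, so that it is positive and dominates [W s x / pi s] on the cell. *)
Definition cell_density (i : C) (s : S) : R := ((i s).+1%:R / (L%:R * pi s))%R.

Definition cell_law (i : C) (s : S) : R :=
  fine (\int[PX]_x (\1_[set x | cell x = i] x * W s x)%:E).

Let LR : (0 < L%:R :> R)%R. Proof. by rewrite ltr0n. Qed.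

Let Wle1 s x : (W s x <= 1)%R.
Proof. by rewrite -(W1 x) (bigD1 s) //= lerDl sumr_ge0. Qed.

Lemma cell_bounds x s : ((cell x s)%:R / L%:R <= W s x < (cell x s).+1%:R / L%:R)%R.
Proof.
have LW0 : (0 <= L%:R * W s x)%R by rewrite mulr_ge0 // ltW.
have := truncn_itv LW0; rewrite /cell ffunE inordK.
  by rewrite ler_pdivrMr // ltr_pdivlMr // mulrC.
rewrite ltnS -(ler_nat R); have /andP[h _] := truncn_itv LW0.
by apply: le_trans h _; rewrite ler_piMr // ltW.
Qed.

Lemma cell_densityP x s : (W s x <= pi s * cell_density (cell x) s)%R.
Proof.
have /andP[_ /ltW h] := cell_bounds x s; apply: le_trans h _.
rewrite /cell_density le_eqVlt; apply/orP; left; apply/eqP.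
by field; rewrite !gt_eqF.
Qed.

Lemma cell_density_gt0 i s : (0 < cell_density i s)%R.
Proof. by rewrite divr_gt0 ?mulr_gt0. Qed.

Lemma measurable_cell i : measurable [set x | cell x = i].
Proof.
have -> : [set x | cell x = i] = \bigcap_(s in setT)
    [set x | ((i s)%:R / L%:R <= W s x < (i s).+1%:R / L%:R)%R].
  apply/seteqP; split => x /=; first by move=> <- s _; exact: cell_bounds.
  move=> h; apply/ffunP => s; have /andP[h1 h2] := h s Logic.I.
  have /andP[h3 h4] := cell_bounds x s; apply/val_inj/eqP; rewrite eqn_leq /=.
  have a1 := le_lt_trans h1 h4; have a2 := le_lt_trans h3 h2.
  move: a1 a2; rewrite !ltr_pM2r ?invr_gt0 // !ltr_nat !ltnS => -> ->.
  by [].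
apply: fin_bigcap_measurable; first exact: finite_finset.
move=> s _.
rewrite (_ : [set x | _] = W s @^-1` `[((i s)%:R / L%:R)%R, ((i s).+1%:R / L%:R)%R[%classic).
  by rewrite -[X in measurable X]setTI; exact: mW.
by apply/seteqP; split => x /=; rewrite in_itv.
Qed.

Lemma measurable_fun_of_cell (D : C -> bool) : measurable_fun setT (fun x => D (cell x)).
Proof.
apply: (@measurable_fun_bool _ _ _ _ true).
rewrite setTI (_ : _ @^-1` _ = \bigcup_(i in [set i | D i]) [set x | cell x = i]); last first.
  apply/seteqP; split => x /=; first by move=> h; exists (cell x).
  by move=> [i /= Di ->].
apply: fin_bigcup_measurable; first exact: finite_finset.
by move=> i _; exact: measurable_cell.
Qed.

Let mF i s : measurable_fun setT (fun x => (\1_[set x | cell x = i] x * W s x)%:E).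
Proof.
apply/measurable_EFinP; apply: measurable_funM => //.
apply: measurable_indic; exact: measurable_cell.
Qed.

Let F0 i s x : 0 <= (\1_[set x | cell x = i] x * W s x)%:E.
Proof. by rewrite lee_fin mulr_ge0. Qed.

Lemma cell_lawE i s : (cell_law i s)%:E = \int[PX]_x (\1_[set x | cell x = i] x * W s x)%:E.
Proof.
rewrite fineK // ge0_fin_numE; last exact: integral_ge0.
apply: (@le_lt_trans _ _ (\int[PX]_x cst 1 x)); last by rewrite integral_one ltry.
by apply: ge0_le_integral => // x _; rewrite lee_fin mulr_ile1.
Qed.

Lemma cell_law_ge0 i s : (0 <= cell_law i s)%R.
Proof. by apply: fine_ge0; exact: integral_ge0. Qed.

Lemma cell_law_sumr i : (\sum_s cell_law i s = fine (PX [set x | cell x = i]))%R.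
Proof.
have mi := measurable_cell i.
apply: EFin_inj; rewrite fineK; last exact: fin_num_measure.
rewrite -sumEFin; under eq_bigr do rewrite cell_lawE.
rewrite -ge0_integral_sum //.
under eq_integral do rewrite sumEFin -mulr_sumr W1 mulr1.
by rewrite integral_indic // setIT.
Qed.

Lemma cell_mpartition : finite_mpartition (fun j : 'I_#|C| => [set x | cell x = enum_val j]).
Proof.
split => [j|j k jk|]; first exact: measurable_cell.
  apply/seteqP; split => x //= [h1 h2]; move: jk; apply/negP; rewrite negbK.
  by apply/eqP/enum_val_inj; rewrite -h1 -h2.
apply/seteqP; split => x // _; rewrite -bigcup_seq.
exists (enum_rank (cell x)); first by rewrite /= mem_index_enum.
by rewrite /= enum_rankK.
Qed.

Lemma cell_law_sum : (\sum_i \sum_s cell_law i s = 1)%R.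
Proof.
under eq_bigr do rewrite cell_law_sumr.
rewrite (big_enum_val (fun i => fine (PX [set x | cell x = i]))).
apply: EFin_inj; rewrite -sumEFin.
under eq_bigr => j _.
  rewrite fineK; last by apply: fin_num_measure; exact: measurable_cell.
  over.
by rewrite (mpartition_measure PX cell_mpartition); exact: probability_setT.
Qed.

(** With [p] the [cell_law], [a] the mass of the cell and [u = p / (a * pi s)], rounding up costs at
    most a factor [1 + a / (L * p)]. By [ln (1 + y) <= y], weighting by [p] leaves a loss [a / L],
    and summing over cells and letters gives [#|S| / L]. *)
Lemma cell_information :
  (\sum_i \sum_s cell_law i s * ln (cell_density i s) <= I0 + #|S|%:R / L%:R)%R.
Proof.
pose a i := fine (PX [set x | cell x = i]).
have a0 i : (0 <= a i)%R by apply: fine_ge0.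
have term i s : (cell_law i s * ln (cell_density i s) <=
    mi_term (cell_law i s) (a i) (pi s) + a i / L%:R)%R.
  rewrite /mi_term; have [->|pn] := eqVneq (cell_law i s) 0%R.
    by rewrite mul0r add0r divr_ge0 // ltW.
  have pp : (0 < cell_law i s)%R by rewrite lt_neqAle eq_sym pn cell_law_ge0.
  have ap : (0 < a i)%R.
    by rewrite /a -cell_law_sumr (bigD1 s) //= ltr_pwDl // sumr_ge0 // => *; exact: cell_law_ge0.
  (* On the cell [W] is at least its rounded-down value. *)
  have pg : ((i s)%:R / L%:R * a i <= cell_law i s)%R.
    rewrite -lee_fin cell_lawE EFinM /a fineK; last by apply: fin_num_measure; exact: measurable_cell.
    rewrite -[X in PX X]setIT -integral_indic //; last exact: measurable_cell.
    have c0 : (0 <= (i s)%:R / L%:R :> R)%R by rewrite divr_ge0.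
    have mI : measurable_fun setT (fun x => (\1_[set x | cell x = i] x)%:E : \bar R).
      apply/measurable_EFinP; apply: measurable_indic; exact: measurable_cell.
    have I0' x : setT x -> 0 <= (\1_[set x | cell x = i] x)%:E :> \bar R by rewrite lee_fin.
    rewrite -(ge0_integralZl_EFin _ measurableT I0' mI c0).
    apply: ge0_le_integral => //.
    - exact: measurable_funeM.
    move=> x _; rewrite -EFinM lee_fin indicE; have [xi|xi] := pselect (cell x = i).
      by rewrite mem_set // mul1r mulr1 -xi; case/andP: (cell_bounds x s).
    by rewrite memNset // mul0r mulr0.
  pose u := (cell_law i s / (a i * pi s))%R.
  have up : (0 < u)%R by rewrite divr_gt0 // mulr_gt0.
  have dens : (cell_density i s <= u * (1 + a i / (L%:R * cell_law i s)))%R.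
    have -> : (u * (1 + a i / (L%:R * cell_law i s)) =
       (cell_law i s / a i + L%:R^-1) / pi s)%R by rewrite /u; field; rewrite !gt_eqF.
    have -> : (cell_density i s = ((i s)%:R / L%:R + L%:R^-1) / pi s)%R.
      by rewrite /cell_density -natr1; field; rewrite !gt_eqF.
    rewrite ler_pM2r ?invr_gt0 // lerD2r ler_pdivlMr //.
  have w0 : (0 < 1 + a i / (L%:R * cell_law i s))%R.
    by rewrite addr_gt0 // divr_gt0 // mulr_gt0.
  have lnd : (ln (cell_density i s) <= ln u + a i / (L%:R * cell_law i s))%R.
    apply: (@le_trans _ _ (ln (u * (1 + a i / (L%:R * cell_law i s)))%R)).
      by rewrite ler_ln ?posrE ?cell_density_gt0 // mulr_gt0.
    rewrite lnM ?posrE // lerD2l; have := ln_le_sub1 w0; lra.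
  apply: (@le_trans _ _ (cell_law i s * (ln u + a i / (L%:R * cell_law i s)))%R).
    by rewrite ler_pM2l.
  rewrite mulrDr lerD2l le_eqVlt; apply/orP; left; apply/eqP.
  by field; rewrite !gt_eqF.
apply: (@le_trans _ _ (\sum_i \sum_s (mi_term (cell_law i s) (a i) (pi s) + a i / L%:R))%R).
  by apply: ler_sum => i _; apply: ler_sum => s _.
under eq_bigr do rewrite big_split /=.
rewrite big_split /=; apply: lerD.
  rewrite (big_enum_val (fun i => \sum_s mi_term (cell_law i s) (a i) (pi s)))%R.
  exact: WI cell_mpartition.
under eq_bigr do rewrite sumr_const.
rewrite sumrMnl -mulr_suml.
have -> : (\sum_i a i = 1)%R by rewrite -cell_law_sum; apply: eq_bigr => i _; rewrite cell_law_sumr.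
by rewrite mul1r -[leLHS]mulr_natl.
Qed.
End cells.

Lemma finite_code_kernel {R : realType} d (O : measurableType d) (Z : finType)
  (theta : Z -> O -> R) (code : Z -> nat) :
  (forall z, measurable_fun setT (theta z)) -> (forall z x, (0 <= theta z x)%R) ->
  (forall x, (\sum_z theta z x = 1)%R) ->
  exists enc : R.-pker O ~> nat, forall x,
    (forall A, enc x A = \sum_z (theta z x)%:E * \d_(code z) A) /\
    forall f : nat -> \bar R, (forall z, 0 <= f z) ->
      \int[enc x]_z f z = \sum_z (theta z x)%:E * f (code z).
Proof.
move=> mt t0 t1.
have /choice[Q QE] x := mixture_probability
  (fun z => (\d_(code z) : probability nat R)) (t0 ^~ x) (t1 x).
have [enc encE] : exists K : R.-pker O ~> nat, forall x, K x = Q x.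
  apply: (@kernel_of_measure _ _ _ _ _ (fun x => Q x)) => [U mU|x]; last exact: probability_setT.
  rewrite (_ : (fun x => _) = fun x => \sum_z (theta z x)%:E * \d_(code z) U); last first.
    by apply/funext => x; exact: (QE x).1.
  apply: emeasurable_sum => z; apply: emeasurable_funM; last exact: measurable_cst.
  exact/measurable_EFinP.
exists enc => x; split => [A|f f0]; first by rewrite encE; exact: (QE x).1.
rewrite encE; apply: (etrans ((QE x).2 f f0 _)) => //.
apply: eq_bigr => z _; congr (_ * _).
by rewrite integral_dirac // diracT mul1e.
Qed.

(** * The block code of a memoryless test channel *)

Section block.
Context {R : realType} {d} {X : measurableType d} (PX : probability X R).
Context {S : finType} (pi : S -> R) (W : S -> X -> R) (Q : S -> probability X R).
Variables (Delta : X -> X -> R) (D I0 : R).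
Hypotheses (pi0 : forall s, (0 < pi s)%R).
Hypotheses (mW : forall s, measurable_fun setT (W s)) (W0 : forall s x, (0 <= W s x)%R).
Hypothesis W1 : forall x, (\sum_s W s x = 1)%R.
Hypothesis Wpi : forall s, \int[PX]_x (W s x)%:E = (pi s)%:E.
Hypothesis WI : forall m (A : 'I_m -> set X), finite_mpartition A ->
  (\sum_i \sum_s mi_term (fine (\int[PX]_x (\1_(A i) x * W s x)%:E)) (fine (PX (A i))) (pi s)
   <= I0)%R.
Hypothesis Qmix : forall B, measurable B -> \sum_s (pi s)%:E * Q s B = PX B.
Hypothesis mDelta : measurable_fun setT (fun p : X * X => Delta p.1 p.2).
Hypothesis Delta0 : forall x y, (0 <= Delta x y)%R.
Let ell (s : S) (x : X) : \bar R := \int[Q s]_y (Delta x y)%:E.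
Hypothesis WD : \int[PX]_x \sum_s (W s x)%:E * ell s x <= D%:E.

Let ell0 s x : 0 <= ell s x.
Proof. by apply: integral_ge0 => y _; rewrite lee_fin. Qed.

Let mell s : measurable_fun setT (ell s).
Proof.
apply: (@measurable_fun_fubini_tonelli_F _ _ X X R (Q s) (fun p => (Delta p.1 p.2)%:E)) => [|p].
  exact/measurable_EFinP.
by rewrite lee_fin.
Qed.

Let pi1 : (\sum_s pi s = 1)%R.
Proof.
apply: EFin_inj; rewrite -sumEFin; under eq_bigr do rewrite -Wpi.
rewrite -ge0_integral_sum //; last 2 first.
- by move=> s; exact/measurable_EFinP.
- by move=> s x _; rewrite lee_fin.
by under eq_integral do rewrite sumEFin W1; exact: integral_one.
Qed.

Section fixed_length.
Variables (n : nat) (Pn : probability (n.-tuple X) R).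
Hypotheses (iidPn : iid_law PX Pn) (n0 : (0 < n)%N).

Let T := {ffun 'I_n -> S}.
Let Wn (s : T) (x : n.-tuple X) : R := (\prod_t W (s t) (tnth x t))%R.
Let pin (s : T) : R := (\prod_t pi (s t))%R.

Let Wn0 s x : (0 <= Wn s x)%R. Proof. by apply: prodr_ge0. Qed.

Let mWn s : measurable_fun setT (Wn s).
Proof.
apply: measurable_prod => t _; apply: measurableT_comp => //.
exact: measurable_tnth.
Qed.

Let Wn1 x : (\sum_s Wn s x = 1)%R.
Proof. exact: (@prod_kernel1 R _ _ (fun t s => W s (tnth x t))). Qed.

Let Wn_marginal x t s : (\sum_(c : T | c t == s) Wn c x = W s (tnth x t))%R.
Proof.
rewrite big_mkcond /=.
rewrite (eq_bigr (fun c : T => Wn c x * (c t == s)%:R)%R); last first.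
  by move=> c _; case: ifP; rewrite ?mulr1 ?mulr0.
apply: (etrans (@prod_kernel_factor1 R _ _ (fun t s => W s (tnth x t)) _ (fun a => (a == s)%:R)%R t)) => //.
by rewrite (bigD1 s) //= eqxx mulr1 big1 ?addr0 // => a /negbTE ->; rewrite mulr0.
Qed.

(** Summing out the other letters of the product channel leaves [W] at place [t], so per-letter
    functionals take their single-letter values. *)
Let Wn_single t (h : S -> X -> \bar R) :
  (forall s, measurable_fun setT (h s)) -> (forall s x, 0 <= h s x) ->
  \int[Pn]_x \sum_s (Wn s x)%:E * h (s t) (tnth x t) =
  \int[PX]_x \sum_s (W s x)%:E * h s x.
Proof.
move=> mh h0.
rewrite -(@integral_tnth _ X R n (fun=> PX) Pn iidPn t (fun x => \sum_s (W s x)%:E * h s x)).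
- apply: eq_integral => x _.
  rewrite (partition_big (fun s : T => s t) predT) //=; apply: eq_bigr => s _.
  rewrite -(Wn_marginal x t s) -sumEFin ge0_sume_distrl; last by move=> c _; rewrite lee_fin.
  by apply: eq_bigr => c /eqP ->.
- apply: emeasurable_sum => s; apply: emeasurable_funM => //; exact/measurable_EFinP.
- by move=> x; apply: sume_ge0 => s _; rewrite mule_ge0 // lee_fin.
Qed.

Section typical.
Variables (L : nat) (b delta : R).
Hypotheses (L0 : (0 < L)%N) (delta0 : (0 < delta)%R).
Hypothesis hb : (I0 + #|S|%:R / L%:R <= b)%R.

Let v (i : {ffun S -> 'I_L.+1}) (s : S) : R := ln (cell_density pi i s).
Let typ (s : T) (x : n.-tuple X) : bool :=
  (\sum_t v (cell W L (tnth x t)) (s t) <= n%:R * (b + delta))%R.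
Let law (w : {ffun S -> 'I_L.+1} * S) : R := cell_law PX W w.1 w.2.
Let var : R := (\sum_w law w * (v w.1 w.2 - \sum_w law w * v w.1 w.2) ^+ 2)%R.

Let mtyp s : measurable_fun setT (typ s).
Proof.
apply: measurable_fun_ler; last exact: measurable_cst.
apply: measurable_sum => t.
apply: (@measurableT_comp _ _ _ _ _ _ (fun x => v (cell W L x) (s t))); last exact: measurable_tnth.
rewrite (_ : (fun x => _) = (fun x => \sum_i (if cell W L x == i then v i (s t) else 0))%R).
  apply: measurable_sum => i; apply: measurable_fun_ifT; last 2 first.
  - exact: measurable_cst.
  - exact: measurable_cst.
  exact: (@measurable_fun_of_cell _ _ _ _ W L L0 mW W0 W1 (fun c => c == i)).
apply/funext => x; rewrite (bigD1 (cell W L x)) //= eqxx big1 ?addr0 // => i.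
by rewrite eq_sym => /negbTE ->.
Qed.

Let typM s x : typ s x -> (Wn s x <= expR (n%:R * (b + delta)) * pin s)%R.
Proof.
move=> hs; apply: (@le_trans _ _ (\prod_t (pi (s t) * cell_density pi (cell W L (tnth x t)) (s t)))%R).
  apply: ler_prod => t _; rewrite W0 /=; exact: cell_densityP.
rewrite big_split /= mulrC; apply: ler_wpM2r.
  by apply: prodr_ge0 => t _; exact: ltW.
rewrite (eq_bigr (fun t => expR (v (cell W L (tnth x t)) (s t)))); last first.
  by move=> t _; rewrite lnK // posrE; exact: cell_density_gt0.
by rewrite -expR_sum ler_expR.
Qed.

(** Typicality sees the block only through its cells. The event thus lives on sequences of pairs of
    a cell and a symbol, which are i.i.d. with law [cell_law], and the finite Chebyshev bound
    applies. *)
Let atypical : \int[Pn]_x (\sum_(s | ~~ typ s x) Wn s x)%:E <= (var / (n%:R * delta ^+ 2))%:E.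
Proof.
pose g (w : {ffun S -> 'I_L.+1} * S) (x : X) : R := (\1_[set x | cell W L x = w.1] x * W w.2 x)%R.
have g0 w x : (0 <= g w x)%R by rewrite mulr_ge0.
have mg w : measurable_fun setT (g w).
  apply: measurable_funM => //; apply: measurable_indic; exact: measurable_cell.
pose A : {set {ffun 'I_n -> {ffun S -> 'I_L.+1} * S}} :=
  [set c : {ffun 'I_n -> {ffun S -> 'I_L.+1} * S} | (n%:R * (b + delta) < \sum_t v (c t).1 (c t).2)%R]%SET.
have mP (c : {ffun 'I_n -> {ffun S -> 'I_L.+1} * S}) :
    measurable_fun setT (fun x : n.-tuple X => (\prod_t g (c t) (tnth x t))%R).
  apply: measurable_prod => t _; apply: measurableT_comp => //; exact: measurable_tnth.
have P0 (c : {ffun 'I_n -> {ffun S -> 'I_L.+1} * S}) (x : n.-tuple X) :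
  (0 <= \prod_t g (c t) (tnth x t))%R by apply: prodr_ge0.
apply: (@le_trans _ _ (\int[Pn]_x \sum_(c <- enum A) (\prod_t g (c t) (tnth x t))%:E)).
  apply: ge0_le_integral => //.
  - by move=> x _; rewrite lee_fin sumr_ge0.
  - apply/measurable_EFinP; under eq_fun do rewrite big_mkcond /=.
    apply: measurable_sum => s; apply: measurable_fun_ifT => //.
    exact: measurableT_comp (mtyp s).
  - by apply: emeasurable_sum => c; exact/measurable_EFinP.
  move=> x _; rewrite sumEFin lee_fin big_enum /=.
  (* For a fixed block, distinct words give distinct sequences of pairs, so the sum over atypical
     words is a part of the sum over [A]. *)
  pose h (s : T) : {ffun 'I_n -> {ffun S -> 'I_L.+1} * S} :=
    [ffun t => (cell W L (tnth x t), s t)].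
  have hinj : injective h.
    by move=> s s' /ffunP e; apply/ffunP => t; have := e t; rewrite !ffunE => -[].
  pose B : {set T} := [set s | ~~ typ s x]%SET.
  have -> : (\sum_(s | ~~ typ s x) Wn s x = \sum_(c in (h @: B)%SET) \prod_t g (c t) (tnth x t))%R.
    rewrite big_imset /=; last by move=> s s' _ _; exact: hinj.
    apply: eq_big => [s|s _]; first by rewrite inE.
    by apply: eq_bigr => t _; rewrite /g ffunE /= indicE mem_set // mul1r.
  rewrite [leRHS](big_setID (h @: B)%SET) /=.
  have -> : (A :&: h @: B = h @: B)%SET.
    apply/finset.setIidPr; apply/fintype.subsetP => _ /imsetP[s sB ->].
    move: sB; rewrite !inE -ltNge => /lt_le_trans; apply.
    by rewrite le_eqVlt; apply/orP; left; apply/eqP; apply: eq_bigr => t _; rewrite ffunE.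
  by rewrite lerDl sumr_ge0.
rewrite ge0_integral_sum //; last 2 first.
- by move=> c; exact/measurable_EFinP.
- by move=> c x _; rewrite lee_fin.
rewrite big_enum /=.
under eq_bigr => c _.
  under eq_integral do rewrite -prodEFin.
  rewrite (@integral_prod_tnth _ X R n (fun=> PX) Pn iidPn (fun t x => (g (c t) x)%:E)); last 2 first.
  - by move=> t; exact/measurable_EFinP.
  - by move=> t x; rewrite lee_fin.
  under eq_bigr do rewrite -(cell_lawE PX L0 mW W0 W1).
  rewrite prodEFin.
  over.
rewrite sumEFin lee_fin.
have := @finite_chebyshev R 'I_n _ law (fun w => v w.1 w.2) b delta.
rewrite card_ord => /(_ _ _ _ delta0 n0) hc.
apply: le_trans (hc _ _ _).
- by rewrite le_eqVlt; apply/orP; left; apply/eqP; apply: eq_bigl => c; rewrite inE.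
- by move=> w; exact: cell_law_ge0.
- rewrite -(pair_bigA _ (fun i s => cell_law PX W i s)) /=.
  exact: (cell_law_sum PX L0 mW W0 W1).
- apply: le_trans hb; rewrite -(pair_bigA _ (fun i s => cell_law PX W i s * v i s)%R) /=.
  exact: (cell_information L0 pi0 mW W0 W1 WI).
Qed.

Variables (K : nat) (gam : R).
Hypotheses (K0 : (0 < K)%N) (gam0 : (0 < gam)%R).
Hypothesis MK : (expR (n%:R * (b + delta)) <= gam ^+ 2 * K%:R)%R.

(** [Some s'] tests whether the symbol of a letter is [s']; [None] is the mean distortion of the
    letter given its symbol. *)
Let h (o : option S) (s : S) (x : X) : \bar R :=
  if o is Some s' then ((s == s')%:R)%:E else ell s x.
Let g (i : 'I_n * option S) (s : T) (x : n.-tuple X) : \bar R := h i.2 (s i.1) (tnth x i.1).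

Let h0 o s x : 0 <= h o s x. Proof. by case: o => [s'|] //=; rewrite lee_fin. Qed.

Let mh o s : measurable_fun setT (h o s).
Proof. by case: o => [s'|] //=; exact: measurable_cst. Qed.

Let hSome s' : \int[PX]_x \sum_s (W s x)%:E * h (Some s') s x = (pi s')%:E.
Proof.
rewrite -Wpi; apply: eq_integral => x _; rewrite (bigD1 s') //= eqxx mule1 big1 ?adde0 //.
by move=> s /negbTE ->; rewrite mule0.
Qed.

Lemma block_code : exists (enc : R.-pker (n.-tuple X) ~> nat) (dec : R.-pker nat ~> n.-tuple X),
  [/\ entropy (code_pmf Pn enc) <=
        (ln 2 + ln ((n * #|S|.+1).+2 * K)%:R
         + (var / (n%:R * delta ^+ 2) + gam) * (n%:R * ln #|S|%:R))%:E,
      code_avg_distortion Delta Pn enc dec <= D%:E &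
      forall t B, measurable B -> code_out_law Pn enc dec t B = PX B].
Proof.
have pin0 s : (0 < pin s)%R by apply: prodr_gt0.
have pin1 : (\sum_s pin s = 1)%R by exact: prod_pmf1.
have mg i s : measurable_fun setT (g i s).
  exact: measurableT_comp (mh i.2 (s i.1)) (measurable_tnth i.1).
have g0 i s x : 0 <= g i s x by exact: h0.
have gE i : \int[Pn]_x \sum_s (Wn s x)%:E * g i s x =
    \int[PX]_x \sum_s (W s x)%:E * h i.2 s x.
  exact: (Wn_single i.1 (mh i.2) (h0 i.2)).
have gfin i : \int[Pn]_x \sum_s (Wn s x)%:E * g i s x < +oo.
  rewrite gE; case: i => t [s'|] /=; first by rewrite (hSome s') ltry.
  by apply: le_lt_trans WD _; rewrite ltry.
have [Z [theta [sigma [mt t0 t1 tg tH]]]] := one_shot_coding K0 pin0 pin1 mWn Wn0 Wn1 mtyp typM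
  gam0 (expR_ge0 _) MK mg g0 gfin atypical.
pose code (z : Z) : nat := enum_rank z.
have [s0 _] : exists s : S, true.
  have := pi1; case: (pickP (@predT S)) => [s _ _|S0]; first by exists s.
  by rewrite big_pred0 // => /esym/eqP; rewrite oner_eq0.
(* Integers that encode no message decode to an arbitrary constant word. *)
pose word (z : nat) : T :=
  if insub z is Some j then sigma (enum_val (j : 'I_#|Z|)) else [ffun=> s0].
have wordK z : word (code z) = sigma z by rewrite /word /code valK enum_rankK.
have [enc encE] := finite_code_kernel code mt t0 t1.
have /choice[q qE] z := tuple_product_box (fun t => Q (word z t)).
have [dec decE] : exists dec : R.-pker nat ~> n.-tuple X, forall z, dec z = q z.
  apply: (@kernel_of_measure _ _ _ _ _ (fun z => q z)) => [U mU|z]; last exact: probability_setT.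
  by move=> _ B mB.
have dec_int z t (f : X -> \bar R) : measurable_fun setT f -> (forall x, 0 <= f x) ->
    \int[dec z]_y f (tnth y t) = \int[Q (word z t)]_y f y.
  by move=> mf f0; rewrite decE; exact: (integral_tnth (qE z)).
have dec_set z t B : measurable B -> dec z [set y | B (tnth y t)] = Q (word z t) B.
  move=> mB; transitivity (\int[dec z]_y (\1_[set y | B (tnth y t)] y)%:E).
    by rewrite integral_indic ?setIT //; exact: measurable_preimage_tnth.
  rewrite (dec_int z t (fun x => (\1_B x)%:E)) //.
    by rewrite integral_indic // setIT.
  by apply/measurable_EFinP; exact: measurable_indic.
have tgE t o : \int[Pn]_x \sum_z (theta z x)%:E * h o (sigma z t) (tnth x t) =
    \int[PX]_x \sum_s (W s x)%:E * h o s x.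
  exact: (etrans (tg (t, o)) (gE (t, o))).
exists enc, dec; split.
- apply: (@le_trans _ _ (\sum_z - (fine (\int[Pn]_x (theta z x)%:E)
      * ln (fine (\int[Pn]_x (theta z x)%:E))))%R%:E); last first.
    rewrite lee_fin; apply: (le_trans tH).
    rewrite card_prod card_option card_ord card_ffun card_ord natrX lnXn ?ltr0n; last first.
      by apply/card_gt0P; exists s0.
    by rewrite -[(ln _ *+ n)%R]mulr_natl.
  have pmfE (j : 'I_#|Z|) : code_pmf Pn enc j = fine (\int[Pn]_x (theta (enum_val j) x)%:E).
    congr fine; apply: eq_integral => x _; rewrite (encE x).1 (bigD1 (enum_val j)) //=.
    rewrite /code enum_valK diracE mem_set // mule1 big1 ?adde0 // => z zj.
    rewrite diracE memNset ?mule0 //= => e; move: zj; apply/negP; rewrite negbK.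
    by apply/eqP; rewrite -[z]enum_rankK; congr enum_val; exact/val_inj.
  have pmf0 z : (#|Z| <= z)%N -> code_pmf Pn enc z = 0%R.
    move=> zZ; rewrite /code_pmf integral0_eq // => x _; rewrite (encE x).1 big1 // => z' _.
    rewrite diracE memNset ?mule0 //= => e; move: zZ; rewrite -e leqNgt.
    by rewrite /code ltn_ord.
  have nn z : 0 <= (- (code_pmf Pn enc z * ln (code_pmf Pn enc z)))%:E.
    rewrite lee_fin oppr_ge0 mulr_ge0_le0 //; last exact/ln_le0/code_pmf_le1.
    by apply: fine_ge0; exact: integral_ge0.
  rewrite /entropy (nneseries_split _ #|Z|) // eseries0; last first.
    by move=> z zZ _; rewrite pmf0 // mul0r oppr0.
  rewrite adde0 big_mkord sumEFin lee_fin (big_enum_val (fun z => - (fine (\int[Pn]_x (theta z x)%:E)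
      * ln (fine (\int[Pn]_x (theta z x)%:E))))%R).
  by apply: ler_sum => j _; rewrite pmfE.
- rewrite /code_avg_distortion.
  apply: (@le_trans _ _ ((n%:R^-1)%:E * \sum_(t < n) D%:E)); last first.
    rewrite sumEFin sumr_const card_ord -[(D *+ n)%R]mulr_natl -EFinM lee_fin mulrA mulVf ?mul1r //.
    by rewrite pnatr_eq0 -lt0n.
  apply: lee_wpmul2l; first by rewrite lee_fin invr_ge0.
  apply: lee_sum => t _; apply: le_trans WD; rewrite -(tgE t None).
  rewrite le_eqVlt; apply/orP; left; apply/eqP; apply: eq_integral => x _.
  have mDx : measurable_fun setT (fun y => (Delta (tnth x t) y)%:E).
    by apply/measurable_EFinP; exact: (measurableT_comp mDelta (pair1_measurable _)).
  rewrite (encE x).2; last by move=> z; apply: integral_ge0 => y _; rewrite lee_fin.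
  apply: eq_bigr => z _; apply: (congr1 (fun a => (theta z x)%:E * a)).
  by rewrite (dec_int _ t _ mDx) ?wordK // => y; rewrite lee_fin.
- move=> t B mB.
  (* The output law is split by the symbol used at place [t]; its probabilities are preserved
     functionals, equal to [pi s'], so [Qmix] gives [PX]. *)
  transitivity (\int[Pn]_x \sum_s' Q s' B * \sum_z (theta z x)%:E * h (Some s') (sigma z t) (tnth x t)).
    apply: eq_integral => x _; rewrite (encE x).2 //.
    under eq_bigr do rewrite dec_set // wordK.
    under [RHS]eq_bigr => s' _.
      rewrite ge0_sume_distrr; last by move=> z _; rewrite mule_ge0 // lee_fin.
      over.
    rewrite exchange_big; apply: eq_bigr => z _ /=.
    rewrite (bigD1 (sigma z t)) //= eqxx mule1 muleC big1 ?adde0 // => s.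
    by rewrite eq_sym => /negbTE ->; rewrite !mule0.
  have mth s' : measurable_fun setT
      (fun x => \sum_z (theta z x)%:E * h (Some s') (sigma z t) (tnth x t)).
    apply: emeasurable_sum => z; apply: emeasurable_funM; first exact/measurable_EFinP.
    exact: measurable_cst.
  have th0 s' x : 0 <= \sum_z (theta z x)%:E * h (Some s') (sigma z t) (tnth x t).
    by apply: sume_ge0 => z _; rewrite mule_ge0 // lee_fin.
  rewrite ge0_integral_sum //; last 2 first.
  - by move=> s'; exact: emeasurable_funM (measurable_cst _) (mth s').
  - by move=> s' x _; rewrite mule_ge0.
  rewrite -(Qmix mB); apply: eq_bigr => s' _.
  by rewrite ge0_integralZl // tgE hSome muleC.
Qed.
End typical.
End fixed_length.

(** The one-cell partition has zero information. *)
Let I0_ge0 : (0 <= I0)%R.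
Proof.
have /WI : finite_mpartition (fun _ : 'I_1 => [set: X]).
  split => [//|i j|]; first by rewrite !ord1 eqxx.
  by rewrite big_ord_recl big_ord0 setU0.
apply: le_trans; rewrite big_ord_recl big_ord0 addr0 big1 // => s _.
have -> : fine (\int[PX]_x (\1_[set: X] x * W s x)%:E) = pi s.
  by under eq_integral do rewrite indicT mul1r; rewrite Wpi.
rewrite /mi_term gt_eqF // (_ : fine (PX setT) = 1%R).
  by rewrite mul1r divff ?ln1 ?mulr0 // gt_eqF.
by rewrite (_ : PX setT = 1) //; exact: probability_setT.
Qed.

(** Of eight parts of [eps], one each goes to the rounding of [W], the typicality slack, the
    codebook index and the uncoded mode; the other four absorb [Cst], which collects the terms that
    do not grow with [n]. *)
Lemma block_achievable (eps : R) : (0 < eps)%R ->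
  exists N : nat, forall n, (N <= n)%N -> forall Pn : probability (n.-tuple X) R,
  iid_law PX Pn ->
  exists (enc : R.-pker (n.-tuple X) ~> nat) (dec : R.-pker nat ~> n.-tuple X),
  [/\ ((n%:R)^-1)%:E * entropy (code_pmf Pn enc) <= (I0 + eps)%:E,
      code_avg_distortion Delta Pn enc dec <= D%:E &
      forall t B, measurable B -> code_out_law Pn enc dec t B = PX B].
Proof.
move=> eps0; pose c : R := #|S|%:R; pose e8 : R := (eps / 8)%R.
have e80 : (0 < e8)%R by rewrite divr_gt0.
have c1 : (1 <= c)%R.
  rewrite ler1n; case: (pickP (@predT S)) => [s _|S0]; first by apply/card_gt0P; exists s.
  by move: pi1; rewrite big_pred0 // => /esym/eqP; rewrite oner_eq0.
have c0 : (0 < c)%R by exact: lt_le_trans c1.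
have lnc0 : (0 <= ln c)%R by exact: ln_ge0.
pose L := (Num.truncn (c / e8)).+1.
have hL : (I0 + #|S|%:R / L%:R <= I0 + e8)%R.
  rewrite lerD2l -/c ler_pdivrMr ?ltr0n // mulrC -ler_pdivrMr //.
  by have /andP[_ /ltW] := truncn_itv (ltW (divr_gt0 c0 e80)).
(* The summand 1 keeps the denominator positive when [ln c] is zero. *)
pose gam : R := (e8 / (1 + ln c))%R.
have gam0 : (0 < gam)%R by rewrite divr_gt0 // ltr_pwDl.
have gamc : (gam * ln c <= e8)%R.
  rewrite /gam mulrAC ler_pdivrMr ?ltr_pwDl // ler_pM2l //; lra.
pose v (w : {ffun S -> 'I_L.+1} * S) : R := ln (cell_density pi w.1 w.2).
pose law (w : {ffun S -> 'I_L.+1} * S) : R := cell_law PX W w.1 w.2.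
pose var : R := (\sum_w law w * (v w - \sum_w law w * v w) ^+ 2)%R.
(* [alpha] linearises the cost of the index: [ln (alpha * m) <= alpha * m - 1] with
   [m = n * (c + 1) + 2] bounds [ln m] by [n * e8] plus a constant. *)
pose alpha : R := (e8 / (c + 1))%R.
have alpha0 : (0 < alpha)%R by rewrite divr_gt0 // addr_gt0.
pose Cst : R := (ln 2 + (2 * alpha - 1 - ln alpha) + ln (gam ^- 2 + 1)
   + var / e8 ^+ 2 * ln c)%R.
exists (Num.truncn (`|Cst| / (4 * e8))).+1 => n Nn Pn iidPn.
have n0 : (0 < n)%N by exact: leq_trans Nn.
have nR : (0 < n%:R :> R)%R by rewrite ltr0n.
have hC : (Cst <= n%:R * (4 * e8))%R.
  apply: le_trans (ler_norm _) _; rewrite -ler_pdivrMr ?mulr_gt0 //.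
  have q0 : (0 <= `|Cst| / (4 * e8))%R by rewrite divr_ge0 // mulr_ge0 // ltW.
  have /andP[_ /ltW h] := truncn_itv q0; apply: le_trans h _.
  by rewrite ler_nat.
pose M : R := expR (n%:R * (I0 + e8 + e8)).
(* With [1 <= M], rounding [K] up to an integer costs only a constant factor. *)
have M1 : (1 <= M)%R by rewrite -expR0 ler_expR mulr_ge0 // !addr_ge0 // ltW.
have M0 : (0 < M)%R by exact: lt_le_trans M1.
have g20 : (0 < gam ^+ 2)%R by rewrite exprn_gt0.
pose K := (Num.truncn (M / gam ^+ 2)).+1.
have MK : (M <= gam ^+ 2 * K%:R)%R.
  rewrite mulrC -ler_pdivrMr //.
  by have /andP[_ /ltW] := truncn_itv (ltW (divr_gt0 M0 g20)).
have KM : (K%:R <= M * (gam ^- 2 + 1))%R.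
  have /andP[h _] := truncn_itv (ltW (divr_gt0 M0 g20)).
  rewrite /K -natr1 mulrDr mulr1; apply: lerD => //.
have [enc [dec [hH hD hO]]] :=
  block_code iidPn n0 (isT : (0 < L)%N) e80 hL (isT : (0 < K)%N) gam0 MK.
exists enc, dec; split => //.
rewrite lee_pdivrMl // -EFinM; apply: (le_trans hH); rewrite lee_fin -/c.
have KR : (0 < K%:R :> R)%R by rewrite ltr0n.
have gp : (0 < gam ^- 2 + 1 :> R)%R by rewrite addr_gt0 // invr_gt0.
have lnK : (ln K%:R <= n%:R * (I0 + e8 + e8) + ln (gam ^- 2 + 1))%R.
  apply: (@le_trans _ _ (ln (M * (gam ^- 2 + 1)))); first by rewrite ler_ln ?posrE // mulr_gt0.
  by rewrite lnM ?posrE // expRK.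
have NI : (0 < (n * #|S|.+1).+2%:R :> R)%R by rewrite ltr0n.
have lnI : (ln (n * #|S|.+1).+2%:R <= n%:R * e8 + (2 * alpha - 1 - ln alpha))%R.
  have := ln_le_sub1 (mulr_gt0 alpha0 NI); rewrite lnM ?posrE //.
  have -> : (alpha * (n * #|S|.+1).+2%:R = n%:R * e8 + 2 * alpha :> R)%R.
    rewrite -addn2 natrD natrM -natr1 -/c /alpha; field.
    by rewrite gt_eqF // addr_gt0.
  lra.
rewrite natrM lnM ?posrE //.
have hv : ((var / (n%:R * e8 ^+ 2) + gam) * (n%:R * ln c) <=
   var / e8 ^+ 2 * ln c + n%:R * e8)%R.
  rewrite mulrDl; apply: lerD.
    rewrite le_eqVlt; apply/orP; left; apply/eqP; field.
    by rewrite !gt_eqF.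
  by rewrite mulrCA ler_pM2l.
have eE : (eps = 8 * e8)%R by rewrite /e8 mulrC divfK.
move: hv lnI lnK hC; rewrite /Cst eE /var /law /v !mulrDr; lra.
Qed.
End block.

(** * Achievability under (A3) *)

Lemma measurable_singleton {R : realType} d (X : measurableType d) (dist : X -> X -> R) (x : X) :
  polish_borel dist -> measurable [set x].
Proof.
move=> [[d0 dE dC dT] _ _ mE].
rewrite -(setCK [set x]); apply: measurableC.
rewrite mE; apply: sub_sigma_algebra => y /= yx.
exists (dist y x) => [|z /= h zx]; last by rewrite zx ltxx in h.
by rewrite lt_neqAle d0 andbT; apply/eqP => /esym/dE.
Qed.

Lemma conditional_probability {R : realType} d (O : measurableType d) (P : probability O R)
  (E : set O) : measurable E -> (0 < fine (P E))%R ->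
  exists P' : probability O R, forall F, measurable F -> (fine (P E))%:E * P' F = P (F `&` E).
Proof.
move=> mE pE.
have iE0 : (0 <= (fine (P E))^-1)%R by rewrite invr_ge0 ltW.
have [|P' P'E] := @probability_of_measure _ _ R (mscale (NngNum iE0) (mrestr P mE)).
  change (((fine (P E))^-1)%:E * P (setT `&` E) = 1).
  rewrite setTI -[X in _ * X]fineK; last exact: fin_num_measure.
  by rewrite -EFinM mulVf // gt_eqF.
exists P' => F mF; rewrite P'E.
change ((fine (P E))%:E * (((fine (P E))^-1)%:E * P (F `&` E)) = P (F `&` E)).
by rewrite muleA -EFinM divff ?mul1e // gt_eqF.
Qed.

(* Radon-Nikodym densities of the components of a finite mixture, normalised so
   that they form a channel at every point and not only almost everywhere. *)
Lemma mixture_densities {R : realType} d (X : measurableType d) (PX : probability X R)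
  (S : finType) (pi : S -> R) (N : S -> probability X R) :
  (forall s, (0 < pi s)%R) ->
  (forall A, measurable A -> \sum_s (pi s)%:E * N s A = PX A) ->
  exists W : S -> X -> R, [/\ (forall s, measurable_fun setT (W s)),
    (forall s x, (0 <= W s x)%R), (forall x, (\sum_s W s x = 1)%R) &
    forall s (g : X -> \bar R), measurable_fun setT g -> (forall x, 0 <= g x) ->
      \int[PX]_x ((W s x)%:E * g x) = (pi s)%:E * \int[N s]_x g x].
Proof.
move=> pi0 mixN.
have pi1 : (\sum_s pi s = 1)%R.
  apply: EFin_inj; rewrite -sumEFin.
  transitivity (PX setT); last exact: probability_setT.
  by rewrite -mixN //; apply: eq_bigr => s _; rewrite [N s _]probability_setT mule1.
have dom s : N s `<< PX.
  apply/null_content_dominatesP => A mA A0.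
  have : (pi s)%:E * N s A <= 0.
    have <- : \sum_s (pi s)%:E * N s A = 0 by rewrite mixN.
    rewrite (bigD1 s) //= leeDl // sume_ge0 // => s' _.
    by rewrite mule_ge0 // lee_fin ltW.
  rewrite pmule_rle0 ?lte_fin // => h; apply/eqP.
  by rewrite eq_le h measure_ge0.
pose f s := Radon_Nikodym_SigmaFinite.f (N s) PX.
have f0 s x : 0 <= f s x by exact: (Radon_Nikodym_SigmaFinite.f_ge0 (dom s)).
have ffin s x : f s x \is a fin_num by exact: (Radon_Nikodym_SigmaFinite.f_fin_num (dom s)).
have mf s : measurable_fun setT (f s).
  exact: measurable_int (Radon_Nikodym_SigmaFinite.f_integrable (dom s)).
pose w s x : R := (pi s * fine (f s x))%R.
have wE s x : (w s x)%:E = (pi s)%:E * f s x by rewrite EFinM fineK.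
have w0 s x : (0 <= w s x)%R by rewrite mulr_ge0 ?fine_ge0 // ltW.
have mw s : measurable_fun setT (w s).
  apply/measurable_EFinP; rewrite (_ : _ \o _ = fun x => (pi s)%:E * f s x); last first.
    by apply/funext => x /=; rewrite wE.
  exact: measurable_funeM.
pose good x := (\sum_s w s x == 1)%R.
have mgood : measurable_fun setT good.
  by apply: measurable_fun_eqr; [exact: measurable_sum|exact: measurable_cst].
(* The mixture is [PX] itself, so the weighted densities sum to 1 almost everywhere; elsewhere the
   constant law [pi] will replace them. *)
have ae_good : ae_eq PX setT (cst 1) (fun x => (\sum_s w s x)%:E).
  apply: integral_ae_eq => //.
  - exact: (finite_measure_integrable_cst PX 1%R measurableT).
  - by apply/measurable_EFinP; exact: measurable_sum.
  - move=> E _ mE; rewrite integral_cst // mul1e.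
    under [RHS]eq_integral do rewrite -sumEFin.
    rewrite ge0_integral_sum //; last 2 first.
    + by move=> s; apply/measurable_EFinP; exact: measurable_funTS.
    + by move=> s x _; rewrite lee_fin.
    rewrite -[LHS](mixN E mE); apply: eq_bigr => s _.
    under [RHS]eq_integral do rewrite wE.
    rewrite ge0_integralZl //; last 2 first.
    + exact: measurable_funTS.
    + by rewrite lee_fin ltW.
    by rewrite -(Radon_Nikodym_SigmaFinite.f_integral (dom s)).
exists (fun s x => if good x then w s x else pi s); split.
- by move=> s; apply: measurable_fun_ifT => //; exact: measurable_cst.
- by move=> s x; case: ifP => // _; exact: ltW.
- by move=> x; case gx: (good x) => //; apply/eqP.
- move=> s g mg g0.
  transitivity (\int[PX]_x ((w s x)%:E * g x)).
    apply: ge0_ae_eq_integral => //.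
    + apply: emeasurable_funM => //; apply/measurable_EFinP.
      by apply: measurable_fun_ifT => //; exact: measurable_cst.
    + by apply: emeasurable_funM => //; exact/measurable_EFinP.
    + by move=> x _; rewrite mule_ge0 // lee_fin; case: ifP => // _; exact: ltW.
    + by move=> x _; rewrite mule_ge0 // lee_fin.
    case: ae_good => M [mM M0 sM]; exists M; split => //.
    move=> x /= h; apply: sM => /= h'; apply: h => _.
    have := h' Logic.I; rewrite /= => -[e].
    by rewrite /good -e eqxx.
  under eq_integral do rewrite wE -muleA [f _ _ * _]muleC.
  rewrite ge0_integralZl //; last 3 first.
  - exact: emeasurable_funM.
  - by move=> x _; rewrite mule_ge0.
  - by rewrite lee_fin ltW.
  by rewrite (Radon_Nikodym_SigmaFinite.change_of_variables (dom s)).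
Qed.

Section finite_valued.
Context {R : realType} {dO d} {O : measurableType dO} {X : measurableType d}.
Variables (P : probability O R) (Y : O -> X).
Hypothesis mY : forall x, measurable (Y @^-1` [set x]).

Lemma finite_support_total (u : seq X) : uniq u -> P (Y @^-1` [set` u]) = 1 ->
  forall F, measurable F -> P F = \sum_(x <- u) P (F `&` Y @^-1` [set x]).
Proof.
move=> uu P1 F mF.
have Yu : Y @^-1` [set` u] = \bigcup_(x in [set` u]) Y @^-1` [set x].
  apply/seteqP; split => w /=; first by move=> h; exists (Y w).
  by move=> [x /= xu ->].
have mu : measurable (Y @^-1` [set` u]).
  by rewrite Yu; apply: fin_bigcup_measurable => //; exact: finite_seq.
have -> : P F = P (F `&` Y @^-1` [set` u]).
  rewrite -{1}(setIT F) -(setUv (Y @^-1` [set` u])) setIUr measureU //; last 3 first.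
  - exact: measurableI.
  - by apply: measurableI => //; exact: measurableC.
  - by rewrite setIACA setICr setI0.
  rewrite [X in _ + X](_ : _ = 0) ?adde0 //.
  apply/eqP; rewrite eq_le measure_ge0 andbT.
  apply: (@le_trans _ _ (P (~` (Y @^-1` [set` u])))).
    by apply: le_measure; rewrite ?inE //; do ?apply: measurableI => //; exact: measurableC.
  by rewrite probability_setC // P1 subee.
transitivity (\int[P]_w \sum_(x <- u) (\1_(F `&` Y @^-1` [set x]) w)%:E).
  rewrite -[in LHS](setIT (F `&` _)) -integral_indic //; last exact: measurableI.
  apply: eq_integral => w _; rewrite sumEFin; congr EFin.
  have [[Fw Yw]|nFY] := pselect ((F `&` Y @^-1` [set` u]) w).
    rewrite indicE mem_set // (bigD1_seq (Y w)) //= indicE mem_set // big1 ?addr0 //.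
    by move=> x /eqP xY; rewrite indicE memNset // => -[_ /esym].
  rewrite indicE memNset // big_seq big1 // => x xu; rewrite indicE memNset // => -[Fw /= Yw].
  by apply: nFY; split => //=; rewrite Yw.
rewrite ge0_integral_sum //.
  by apply: eq_bigr => x _; rewrite integral_indic ?setIT //; exact: measurableI.
by move=> x; apply/measurable_EFinP; apply: measurable_indic; exact: measurableI.
Qed.

(** Points of probability zero are dropped, since conditioning will require positive mass. *)
Lemma finite_support_atoms (S0 : set X) : finite_set S0 -> P (Y @^-1` S0) = 1 ->
  exists (m : nat) (val : 'I_m -> X), [/\ injective val,
    (forall i, (0 < fine (P (Y @^-1` [set val i])))%R) &
    forall F, measurable F -> P F = \sum_i P (F `&` Y @^-1` [set val i])].
Proof.
move=> /finite_seqP[s ->] P1.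
pose u := undup s; pose s' := [seq x <- u | P (Y @^-1` [set x]) != 0].
have uu : uniq u by exact: undup_uniq.
have us' : uniq s' by exact: filter_uniq.
have Pu : P (Y @^-1` [set` u]) = 1.
  rewrite -P1; congr (P _); apply/seteqP; split => w /=; by rewrite mem_undup.
exists (size s'), (tnth (in_tuple s')); split.
- by apply/tuple_uniqP.
- move=> i; have := mem_tnth i (in_tuple s'); rewrite mem_filter => /andP[h _].
  rewrite lt_neqAle fine_ge0 // andbT eq_sym fine_eq0 //.
  exact: fin_num_measure.
- move=> F mF; rewrite (finite_support_total uu Pu mF).
  rewrite -(big_tnth _ _ s' predT (fun x => P (F `&` Y @^-1` [set x]))) big_filter.
  rewrite [LHS](bigID (fun x => P (Y @^-1` [set x]) != 0)) /= [X in _ + X]big1 ?adde0 //.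
  move=> x; rewrite negbK => /eqP h; apply/eqP; rewrite eq_le measure_ge0 andbT -h.
  by apply: le_measure; rewrite ?inE //; exact: measurableI.
Qed.
End finite_valued.

(** One [eps] is spent in (A3) and the other in block coding. [N i] and [Q i] are the laws of the
    source and of the reproduction given the [i]-th atom of [Xt]. *)
Lemma achievability {R : realType} d (X : measurableType d) (dist : X -> X -> R)
  (PX : probability X R) (Delta : X -> X -> R)
  (dv : probability X R -> probability X R -> \bar R) (D r eps : R) :
  polish_borel dist -> is_distortion Delta -> is_divergence dv ->
  assumption_A3 PX Delta dv -> (0 < D)%R -> (0 < eps)%R ->
  RDP PX Delta dv D 0 <= r%:E ->
  achievable_pr PX Delta dv D 0 (r + eps + eps).
Proof.
move=> pol [mDelta Delta0 _] [_ _ dvE] A3 D0 eps0 hr.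
have msing (x : X) : measurable [set x] := measurable_singleton x pol.
have [dO [Om [P [X0 [Xt [Xh [[mX0 mXt mXh lawX0] [fS markov hI hD lawXh]]]]]]]] := A3 D eps D0 eps0.
have pre (V : Om -> X) : measurable_fun setT V -> forall A, measurable A -> measurable (V @^-1` A).
  by move=> mV A mA; rewrite -[V @^-1` A]setTI; exact: mV.
have mXt1 x : measurable (Xt @^-1` [set x]) by exact: pre.
have [S0 [finS0 PS0]] := fS.
have [m [val [val_inj pval tot]]] := finite_support_atoms mXt1 finS0 PS0.
pose pi i := fine (P (Xt @^-1` [set val i])).
have piE i : (pi i)%:E = P (Xt @^-1` [set val i]) by rewrite fineK //; exact: fin_num_measure.
have /choice[Pc PcE] i := conditional_probability (mXt1 (val i)) (pval i).
have /choice[N NE] i := probability_image (Pc i) mX0.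
have /choice[Q QE] i := probability_image (Pc i) mXh.
have piN i A : measurable A -> (pi i)%:E * N i A = P (X0 @^-1` A `&` Xt @^-1` [set val i]).
  by move=> mA; rewrite (NE i).1 PcE //; exact: pre.
have piQ i A : measurable A -> (pi i)%:E * Q i A = P (Xh @^-1` A `&` Xt @^-1` [set val i]).
  by move=> mA; rewrite (QE i).1 PcE //; exact: pre.
have mixN A : measurable A -> \sum_i (pi i)%:E * N i A = PX A.
  move=> mA; rewrite -(lawX0 A mA) [RHS]tot; last exact: pre.
  by apply: eq_bigr => i _; exact: piN.
have Qmix A : measurable A -> \sum_i (pi i)%:E * Q i A = PX A.
  move=> mA; rewrite -(lawXh A mA) [RHS]tot; last exact: pre.
  by apply: eq_bigr => i _; exact: piQ.
have [W [mW W0 W1 WE]] := mixture_densities pval mixN.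
have Wpi i : \int[PX]_x (W i x)%:E = (pi i)%:E.
  under eq_integral do rewrite -[_%:E]mule1.
  by rewrite (WE i (cst 1)) // integral_one mule1.
have WA i A : measurable A ->
    \int[PX]_x (\1_A x * W i x)%:E = P (X0 @^-1` A `&` Xt @^-1` [set val i]).
  move=> mA; under eq_integral do rewrite mulrC EFinM.
  rewrite (WE i (fun x => (\1_A x)%:E)) //; last first.
    by apply/measurable_EFinP; exact: measurable_indic.
  by rewrite integral_indic // setIT piN.
have WI k (A : 'I_k -> set X) : finite_mpartition A ->
  (\sum_i \sum_s mi_term (fine (\int[PX]_x (\1_(A i) x * W s x)%:E)) (fine (PX (A i))) (pi s)
   <= r + eps)%R.
  move=> pA; have [mA _ _] := pA.
  (* The atoms are completed to a partition by the complement of their set, placed at [ord0]; [Xt]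
     meets it with probability zero, so its terms vanish. *)
  pose B (j : 'I_m.+1) : set X :=
    if unlift ord0 j is Some i then [set val i] else ~` range val.
  have pB : finite_mpartition B.
    split.
    - move=> j; rewrite /B; case: unliftP => [i _|_]; first exact: msing.
      apply: measurableC; rewrite -[range val]bigcup_imset1.
      by apply: fin_bigcup_measurable => //; exact: finite_finset.
    - move=> i j; rewrite /B; case: unliftP => [i' ->|->]; case: unliftP => [j' ->|->] ij.
      + apply/seteqP; split => x //= [-> /val_inj e]; by rewrite e eqxx in ij.
      + by apply/seteqP; split => x //= [-> h]; apply: h; exists i'.
      + by apply/seteqP; split => x //= [h e]; apply: h; exists j'.
      + by rewrite eqxx in ij.
    - apply/seteqP; split => x // _; rewrite -bigcup_seq.
      have [[i _ <-]|nx] := pselect (range val x).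
        by exists (lift ord0 i); rewrite /= ?mem_index_enum // /B liftK.
      by exists ord0; rewrite /= ?mem_index_enum // /B unlift_none.
  have := le_trans (ereal_sup_ubound _) hI.
  move=> /(_ (\sum_(i < k) \sum_(j < m.+1) mi_term
      (fine (P [set w | (A i `*` B j) (X0 w, Xt w)]))
      (fine (P [set w | (A i `*` setT) (X0 w, Xt w)]))
      (fine (P [set w | (setT `*` B j) (X0 w, Xt w)])))%R%:E).
  move=> h; rewrite -lee_fin; apply: (@le_trans _ _ (RDP PX Delta dv D 0 + eps%:E)); last first.
    by rewrite EFinD leeD2r.
  apply: le_trans (h _); last by exists k, m.+1, A, B.
  rewrite lee_fin; apply: ler_sum => i _; rewrite big_ord_recl.
  have z0 : P [set w | (A i `*` B ord0) (X0 w, Xt w)] = 0.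
    rewrite tot.
      rewrite big1 // => s _; rewrite (_ : _ `&` _ = set0) ?measure0 //.
      apply/seteqP; split => w //= [[_]]; rewrite /B unlift_none /= => nr e.
      by apply: nr; exists s.
    rewrite (_ : [set w | _] = X0 @^-1` A i `&` Xt @^-1` B ord0).
      by apply: measurableI; apply: pre => //; case: pB.
    by apply/seteqP; split.
  have m0 b c : mi_term (fine (P [set w | (A i `*` B ord0) (X0 w, Xt w)])) b c = 0%R.
    by rewrite z0 /mi_term eqxx.
  rewrite m0 add0r le_eqVlt; apply/orP; left; apply/eqP; apply: eq_bigr => s _.
  congr mi_term.
  + rewrite WA //; congr (fine (P _)); apply/seteqP; split => w /=; by rewrite /B liftK.
  + rewrite -(lawX0 _ (mA i)); congr (fine (P _)); apply/seteqP; split => w /=; by [|case].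
  + congr (fine (P _)); apply/seteqP; split => w /=; by [rewrite /B liftK|case; rewrite /B liftK].
have WD : \int[PX]_x \sum_s (W s x)%:E * \int[Q s]_y (Delta x y)%:E <= D%:E.
  apply: le_trans hD.
  have mDE : measurable_fun setT (fun p : X * X => (Delta p.1 p.2)%:E) by exact/measurable_EFinP.
  have DE0 (p : X * X) : 0 <= (Delta p.1 p.2)%:E by rewrite lee_fin.
  have mpair : measurable_fun setT (fun w => (X0 w, Xh w)) by exact: measurable_fun_pair.
  have mell s : measurable_fun setT (fun x => \int[Q s]_y (Delta x y)%:E).
    exact: (@measurable_fun_fubini_tonelli_F _ _ X X R (Q s) (fun p => (Delta p.1 p.2)%:E)).
  have ell0 s x : 0 <= \int[Q s]_y (Delta x y)%:E.
    by apply: integral_ge0 => y _; rewrite lee_fin.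
  have pi1 : (\sum_i pi i = 1)%R.
    apply: EFin_inj; rewrite -sumEFin.
    transitivity (PX setT); last exact: probability_setT.
    by rewrite -mixN //; apply: eq_bigr => i _; rewrite [N i _]probability_setT mule1.
  (* [P] is the mixture of its conditional laws given the atoms, so the mean distortion splits over
     the atoms. *)
  have [P' [P'E P'int]] := mixture_probability Pc (fun i => ltW (pval i)) pi1.
  rewrite (eq_measure_integral P'); last first.
    move=> F mF _; apply: (etrans (tot F mF)); apply/esym; apply: (etrans (P'E F)).
    by apply: eq_bigr => i _; exact: PcE.
  rewrite P'int //; last 2 first.
  - by move=> w; rewrite lee_fin.
  - exact: (measurableT_comp mDE mpair).
  rewrite ge0_integral_sum //; last 2 first.
  - by move=> s; apply: emeasurable_funM => //; exact/measurable_EFinP.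
  - by move=> s x _; rewrite mule_ge0 // lee_fin.
  apply: lee_sum => s _; rewrite WE //.
  apply: lee_wpmul2l; first by rewrite lee_fin ltW.
  rewrite le_eqVlt; apply/orP; left; apply/eqP.
  have [J [JE Jint]] := probability_image (Pc s) mpair.
  rewrite -(Jint (fun p => (Delta p.1 p.2)%:E) mDE DE0).
  (* Given an atom, the Markov chain makes [X0] and [Xh] independent: the conditional law of the
     pair agrees with the product on rectangles. *)
  rewrite (@eq_measure_integral _ _ _ setT (N s \x Q s)%E J); last first.
    move=> C mC _; apply/esym; apply: product_measure_unique => // A B mA mB.
    have pp : pi s != 0%R by rewrite gt_eqF //; exact: pval.
    pose p F := fine (P F).
    have pE F : measurable F -> P F = (p F)%:E by move=> mF; rewrite fineK //; exact: fin_num_measure.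
    have m0 := pre _ mX0 _ mA; have mh := pre _ mXh _ mB; have mt := mXt1 (val s).
    have cE F : measurable F -> Pc s F = (p (F `&` Xt @^-1` [set val s]) / pi s)%:E.
      move=> mF; have := PcE s F mF; rewrite -/(pi s) [in RHS]pE; last exact: measurableI.
      rewrite -[Pc s F]fineK; last exact: fin_num_measure.
      by rewrite -EFinM => -[<-]; rewrite mulrC mulKf.
    have e1 : J (A `*` B) = (p ((X0 @^-1` A `&` Xh @^-1` B) `&` Xt @^-1` [set val s]) / pi s)%:E.
      by rewrite JE -cE //; exact: measurableI.
    have e2 : N s A = (p (X0 @^-1` A `&` Xt @^-1` [set val s]) / pi s)%:E.
      by rewrite (NE s).1 cE.
    have e3 : Q s B = (p (Xh @^-1` B `&` Xt @^-1` [set val s]) / pi s)%:E.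
      by rewrite (QE s).1 cE.
    apply: (etrans e1); apply/esym; apply: (etrans (congr2 mule e2 e3)).
    rewrite -EFinM; congr EFin; apply/esym.
    have := markov A B (val s) mA mB.
    rewrite (_ : [set w | A (X0 w) /\ _] = (X0 @^-1` A `&` Xh @^-1` B) `&` Xt @^-1` [set val s]); last first.
      by apply/seteqP; split => w /= [] => [? []|[]].
    rewrite (_ : [set w | A (X0 w) /\ Xt w = val s] = X0 @^-1` A `&` Xt @^-1` [set val s]) //.
    rewrite (_ : [set w | Xt w = val s /\ B (Xh w)] = Xh @^-1` B `&` Xt @^-1` [set val s]); last first.
      by apply/seteqP; split => w /= [].
    rewrite -piE !pE; try by do ?apply: measurableI.
    rewrite -!EFinM => -[] e.
    rewrite mulf_div -e -mulf_div divff // mulr1; congr (p _ / _)%R.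
  by rewrite fubini_tonelli1.
have [N0 hN0] := block_achievable pval mW W0 W1 Wpi WI Qmix mDelta Delta0 WD eps0.
exists N0 => n nN Pn iidPn; have [enc [dec [h1 h2 h3]]] := hN0 n nN Pn iidPn.
exists enc, dec; split => // t; exists PX; split; last by rewrite ((dvE PX PX).2 _).
by move=> B mB; rewrite h3.
Qed.

Theorem theorem4 (R : realType) (d : measure_display) (X : measurableType d)
  (dist : X -> X -> R) (PX : probability X R) (Delta : X -> X -> R)
  (dv : probability X R -> probability X R -> \bar R) :
  polish_borel dist ->
  is_distortion Delta ->
  is_divergence dv ->
  divergence_convex dv ->                (* (A1) *)
  assumption_A3 PX Delta dv ->           (* (A3) *)
  forall D : R, (0 < D)%R -> Rpr PX Delta dv D 0 = RDP PX Delta dv D 0.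
Proof.
move=> pol dist_D div_dv _ A3 D D0; apply/eqP; rewrite eq_le; apply/andP; split; last first.
  by apply: le_ereal_inf_tmp => _ [r hr <-]; exact: (converse dist_D div_dv hr).
have [hy|hy] := eqVneq (RDP PX Delta dv D 0) +oo; first by rewrite hy leey.
(* The one-cell partition makes every mutual information nonnegative, which excludes the value [-oo]
   and leaves [RDP] finite. *)
have RDP0 : 0 <= RDP PX Delta dv D 0.
  apply: le_ereal_inf_tmp => _ [k _ <-]; apply: ereal_sup_ubound.
  have pT : finite_mpartition (fun _ : 'I_1 => [set: X]).
    split => [//|i j|]; first by rewrite !ord1 eqxx.
    by rewrite big_ord_recl big_ord0 setU0.
  exists 1%N, 1%N, (fun=> setT), (fun=> setT); split => //.
  rewrite !big_ord_recl !big_ord0 !addr0 joint_law_margl //.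
  rewrite (_ : PX setT = 1); last exact: probability_setT.
  by rewrite /mi_term oner_eq0 mulr1 divr1 ln1 mulr0.
have fin : RDP PX Delta dv D 0 \is a fin_num by rewrite ge0_fin_numE // ltey.
apply/lee_addgt0Pr => e e0; rewrite -(fineK fin) -EFinD.
have e20 : (0 < e / 2)%R by rewrite divr_gt0.
have hr : RDP PX Delta dv D 0 <= (fine (RDP PX Delta dv D 0))%:E by rewrite fineK.
apply: ereal_inf_lbound; exists (fine (RDP PX Delta dv D 0) + e)%R => //=.
have := achievability pol dist_D div_dv A3 D0 e20 hr.
by rewrite -addrA -splitr.
Qed.
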